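(* Let $0 \leq \alpha < 1$, $1/2\leq \gamma < 1$ and $\beta>0$ with $0<\beta\gamma\leq 1$. Then there exists $n_0$ such that for every $n\geq n_0$ the following holds: among all connected graphs $G$ on $n$ vertices, the quantity $\lambda^{(\alpha)}_1 (G) - \beta\cdot\lambda^{(\gamma)}_n (G)$ is maximized only by the kite graph $Ki_{n,n-1}$ (i.e. $Ki_{n,n-1}$ attains the maximum and every connected $n$-vertex graph attaining the maximum is isomorphic to $Ki_{n,n-1}$).
   Context: All graphs are finite, simple and undirected. For a graph $G$ on $n$ vertices and a real number $\alpha\in[0,1]$, the $A_\alpha$-matrix is $A_{\alpha}(G) = \alpha D(G) + (1-\alpha) A(G)$, where $D(G)$ is the diagonal matrix of vertex degrees and $A(G)$ is the adjacency matrix. $\lambda_1^{(\alpha)}(G)$ and $\lambda_n^{(\alpha)}(G)$ denote the largest and smallest eigenvalues of $A_\alpha(G)$, respectively. The kite graph $Ki_{n,n-1}$ is the graph obtained from a complete graph on $n-1$ vertices by attaching a pendant edge (a new vertex of degree $1$) to one of its vertices. *)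

(* Defs.v *)
From mathcomp Require Import all_boot all_order all_algebra all_fingroup.
From mathcomp Require Import complex polyrcf.
From mathcomp Require Import boolp classical_sets reals.

Set Implicit Arguments.
Unset Strict Implicit.
Unset Printing Implicit Defensive.

Import Order.TTheory GRing.Theory Num.Theory.
Local Open Scope ring_scope.

Record sgraph (n : nat) := SGraph {
  adj : rel 'I_n;
  adj_sym : symmetric adj;
  adj_irr : irreflexive adj }.

Definition degree n (G : sgraph n) (i : 'I_n) : nat := #|[set j | adj G i j]|.

Definition graph_connected n (G : sgraph n) : Prop := forall i j, connect (adj G) i j.

Definition graph_iso n (G H : sgraph n) : Prop :=
  exists s : {perm 'I_n}, forall i j, adj H (s i) (s j) = adj G i j.

(* The vertices 0, ..., n-2 form a clique, and the last vertex n-1 is pendant,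
   attached to vertex 0. *)
Definition kite_rel n : rel 'I_n := fun i j =>
  (i != j) &&
  [|| (i < n.-1) && (j < n.-1),
      (i == 0 :> nat) && (j == n.-1 :> nat) |
      (i == n.-1 :> nat) && (j == 0 :> nat)]%N.

Lemma kite_sym n : symmetric (@kite_rel n).
Proof.
move=> i j; rewrite /kite_rel eq_sym [(i < _)%N && _]andbC.
by rewrite [_ && (j == _ :> nat)]andbC [_ && (j == 0%N :> nat)]andbC [X in _ || X]orbC.
Qed.

Lemma kite_irr n : irreflexive (@kite_rel n).
Proof. by move=> i; rewrite /kite_rel eqxx. Qed.

Definition kite n : sgraph n := SGraph (@kite_sym n) (@kite_irr n).

Section Spectrum.
Variable R : realType.

Definition adjacency_mx n (G : sgraph n) : 'M[R]_n :=
  \matrix_(i, j) (adj G i j)%:R.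

Definition degree_mx n (G : sgraph n) : 'M[R]_n :=
  diag_mx (\row_i (degree G i)%:R).

Definition Aalpha_mx (alpha : R) n (G : sgraph n) : 'M[R]_n :=
  alpha *: degree_mx G + (1 - alpha) *: adjacency_mx G.

(* For a symmetric matrix of positive size, these are the largest and the
   smallest eigenvalue: see [max_eigenvalueP] and [min_eigenvalueP] below. *)
Definition max_eigenvalue n (M : 'M[R]_n) : R :=
  sup [set a : R | eigenvalue M a]%classic.

Definition min_eigenvalue n (M : 'M[R]_n) : R :=
  inf [set a : R | eigenvalue M a]%classic.

Definition lambda_max (alpha : R) n (G : sgraph n) : R :=
  max_eigenvalue (Aalpha_mx alpha G).

Definition lambda_min (alpha : R) n (G : sgraph n) : R :=
  min_eigenvalue (Aalpha_mx alpha G).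

Lemma Aalpha_mx_sym (alpha : R) n (G : sgraph n) :
  (Aalpha_mx alpha G)^T = Aalpha_mx alpha G.
Proof.
rewrite /Aalpha_mx linearD !linearZ /= tr_diag_mx; congr (_ + _ *: _).
by apply/matrixP=> i j; rewrite !mxE adj_sym.
Qed.

Lemma sym_eigenvalue n (M : 'M[R]_n) :
  (0 < n)%N -> M^T = M -> exists a, eigenvalue M a.
Proof.
move=> n_gt0 symM; pose f := real_complex R; pose Mc := map_mx f M.
have /closed_rootP[z] : size (char_poly Mc) != 1%N.
  by rewrite size_char_poly eqSS -lt0n.
rewrite -eigenvalue_root_char => ez; have /eigenvalueP[v vM v0] := ez.
pose w := map_mx Num.conj v.
have McT : Mc^T = Mc by rewrite /Mc map_trmx symM.
have wM : w *m Mc = z^* *: w.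
  have -> : Mc = map_mx Num.conj Mc.
    by apply/matrixP=> i j; rewrite !mxE /f; apply/esym/CrealP/complex_realP; eexists.
  by rewrite /w -map_mxM vM map_mxZ.
have eqz : z *: (v *m w^T) = z^* *: (v *m w^T).
  rewrite scalemxAl -vM -mulmxA -{1}McT -trmx_mul wM linearZ /=.
  by rewrite -scalemxAr.
have nz : (v *m w^T) 0 0 != 0.
  rewrite mxE psumr_eq0; last by move=> i _; rewrite !mxE mul_conjC_ge0.
  apply: contraNN v0 => /allP h; apply/eqP/matrixP=> i j; rewrite ord1 !mxE.
  by have := h j (mem_index_enum _); rewrite !mxE mul_conjC_eq0 => /eqP.
have /CrealP/complex_realP[a za] : z^* = z.
  move: eqz nz; set X := _ *m _ => /matrixP/(_ 0 0); rewrite !mxE => eqz nz.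
  exact: esym (mulIf nz eqz).
by exists a; rewrite za (eigenvalue_map f) in ez.
Qed.

Lemma eigenvalue_in_roots n (M : 'M[R]_n) a :
  eigenvalue M a = (a \in rootsR (char_poly M)).
Proof.
by rewrite eigenvalue_root_char -roots_on_rootsR ?monic_neq0 ?char_poly_monic.
Qed.

Lemma seq_max (s : seq R) x :
  x \in s -> exists2 m, m \in s & forall y, y \in s -> y <= m.
Proof.
elim: s x => // a [|b s] IHs x _.
  by exists a; rewrite ?mem_head // => y; rewrite inE => /eqP->.
have [m ms mP] := IHs b (mem_head _ _).
exists (Num.max a m).
  by case: leP => _; rewrite in_cons ?eqxx // ms orbT.
move=> y; rewrite in_cons => /predU1P[->|/mP ym]; first by rewrite le_max lexx.
by rewrite le_max ym orbT.
Qed.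

Lemma seq_min (s : seq R) x :
  x \in s -> exists2 m, m \in s & forall y, y \in s -> m <= y.
Proof.
move=> xs; have [_ /mapP[m ms ->] mP] := seq_max (map_f -%R xs).
by exists m => // y ys; rewrite -lerN2 mP ?map_f.
Qed.

Lemma max_eigenvalueP n (M : 'M[R]_n) : (0 < n)%N -> M^T = M ->
  eigenvalue M (max_eigenvalue M) /\
  forall a, eigenvalue M a -> a <= max_eigenvalue M.
Proof.
move=> n_gt0 /(sym_eigenvalue n_gt0)[x]; rewrite eigenvalue_in_roots.
case/seq_max=> m; rewrite -eigenvalue_in_roots => em mP.
have ubm : ubound [set a : R | eigenvalue M a]%classic m.
  by move=> a /=; rewrite eigenvalue_in_roots; apply: mP.
suff -> : max_eigenvalue M = m by split.
apply/le_anti/andP; split; first by apply: ge_sup => //; exists m.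
by apply: ub_le_sup => //; exists m.
Qed.

Lemma min_eigenvalueP n (M : 'M[R]_n) : (0 < n)%N -> M^T = M ->
  eigenvalue M (min_eigenvalue M) /\
  forall a, eigenvalue M a -> min_eigenvalue M <= a.
Proof.
move=> n_gt0 /(sym_eigenvalue n_gt0)[x]; rewrite eigenvalue_in_roots.
case/seq_min=> m; rewrite -eigenvalue_in_roots => em mP.
have lbm : lbound [set a : R | eigenvalue M a]%classic m.
  by move=> a /=; rewrite eigenvalue_in_roots; apply: mP.
suff -> : min_eigenvalue M = m by split.
apply/le_anti/andP; split; first by apply: ge_inf => //; exists m.
by apply: lb_le_inf => //; exists m.
Qed.

Definition maximizer n (F : sgraph n -> R) (G : sgraph n) : Prop :=
  graph_connected G /\ forall H : sgraph n, graph_connected H -> F H <= F G.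

End Spectrum.

(* Main.v *)
Require Import Defs.
From mathcomp Require Import all_boot all_order all_algebra all_fingroup.
From mathcomp Require Import complex spectral.
From mathcomp Require Import reals.
From mathcomp Require Import ring lra zify.

(** Write [t = sqrt n], [lam] for the largest eigenvalue of [A_alpha(G)] and
    [mu] for the smallest eigenvalue of [A_gamma(G)].  Test vectors show that the
    kite has value at least [n - 2 - beta * gamma >= n - 3], so a competitor [G]
    has [lam >= n - 3] and [mu = O(1)].  Bounding the adjacency form by its
    Frobenius norm, [lam >= n - 3] forces [G] to have only [O(n)] non-edges, and
    applying the same bound to the complement shows that a unit [mu]-eigenvector
    [z] has mass [O(1 / t)] outside the bounded set [L] of vertices of degree less
    than [eta * n].

    - If [L] is empty, [z] has no room for its mass.
    - If [L] has two vertices, [lam <= n - 3 + 8 * eta], while connectedness keeps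
      [mu] above a positive constant independent of [eta].
    - If [L] is a single vertex of degree [k >= 2], [lam <= n - 2 + 4 * k / n] and
      [mu] is nearly [gamma * k] or more.
    - If [L] is a single vertex of degree 1, [G] embeds in the kite.  Entries of
      the two eigenvectors at high degree vertices are of order [1 / t] for [lam]
      and [O(t ^ (- 3 / 2))] for [mu], so every missing edge costs order [1 / n] in
      [lam] and only [O(n ^ (- 3 / 2))] in [mu]. *)

Set Implicit Arguments.
Unset Strict Implicit.
Unset Printing Implicit Defensive.

Import Order.TTheory GRing.Theory Num.Theory.
Local Open Scope ring_scope.

(** * Rayleigh quotients and the quadratic form of the A_alpha matrix *)

(** Over the complex numbers [M] is Hermitian, so it has a unitary diagonalisation with real
    diagonal, and the form becomes a sum of eigenvalues weighted by squared moduli. *)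
Lemma symmetric_rayleigh_le (R : realType) n (M : 'M[R]_n) (l : R) :
    M^T = M -> (forall a, eigenvalue M a -> a <= l) ->
  forall v : 'rV[R]_n, (v *m M *m v^T) 0 0 <= l * (v *m v^T) 0 0.
Proof.
move=> symM lP v; pose f := real_complex R; pose Mc := map_mx f M.
have conjf (m p : nat) (A : 'M[R]_(m, p)) : map_mx Num.conj (map_mx f A) = map_mx f A.
  by apply/matrixP=> i j; rewrite !mxE /f; apply/CrealP/complex_realP; eexists.
have Mherm : Mc \is hermsymmx.
  by apply/is_hermitianmxP; rewrite expr0 scale1r map_trmx conjf symM.
have spR := hermitian_spectral_diag_real Mherm.
have /orthomx_spectralP := hermitian_normalmx Mherm.
set P := spectralmx Mc; set sp := spectral_diag Mc in spR * => McE.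
have uP : P \is unitarymx := spectral_unitarymx Mc.
have unP := unitarymx_unit uP.
(* Row [i] of [P] is an eigenvector for [sp 0 i], nonzero because [P] is invertible. *)
have sp_le i : sp 0 i <= f l.
  have /complex_realP[a spa] : sp 0 i \is Num.real by move/mxOverP: spR; apply.
  rewrite spa lecR; apply: lP; rewrite -(eigenvalue_map f).
  set b := (X in eigenvalue _ X); have -> : b = sp 0 i by rewrite spa.
  apply/eigenvalueP; exists (row i P).
    have PM : P *m Mc = diag_mx sp *m P by rewrite McE !mulmxA mulmxV // mul1mx.
    by rewrite -row_mul PM row_mul row_diag_mx -scalemxAl -rowE.
  have /row_freeP[B PB] : row_free P by rewrite row_free_unit.
  apply/eqP => r0; have := congr1 (row i) PB.
  rewrite row_mul r0 mul0mx => /rowP/(_ i); rewrite !mxE eqxx => /eqP.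
  by rewrite eq_sym oner_eq0.
pose vc := map_mx f v; pose w := vc *m (P ^t*)%sesqui.
have vcE : (vc ^t*)%sesqui = map_mx f v^T by rewrite map_trmx conjf.
have wE : (w ^t*)%sesqui = P *m map_mx f v^T.
  by rewrite trmx_mul map_mxM vcE trmxCK.
have E1 : vc *m Mc *m map_mx f v^T = w *m diag_mx sp *m (w ^t*)%sesqui.
  by rewrite wE McE invmx_unitary // /w !mulmxA.
have E2 : vc *m map_mx f v^T = w *m (w ^t*)%sesqui.
  by rewrite wE /w -invmx_unitary // mulmxA mulmxKV.
suff : f ((v *m M *m v^T) 0 0) <= f l * f ((v *m v^T) 0 0).
  by rewrite /f -rmorphM lecR.
have -> : f ((v *m M *m v^T) 0 0) = (vc *m Mc *m map_mx f v^T) 0 0.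
  by rewrite -!map_mxM [RHS]mxE.
have -> : f ((v *m v^T) 0 0) = (vc *m map_mx f v^T) 0 0.
  by rewrite -map_mxM [RHS]mxE.
rewrite E1 E2 mul_mx_diag mxE [X in _ <= _ * X]mxE mulr_sumr.
apply: ler_sum => i _; rewrite !mxE mulrAC mulrC.
by apply: ler_wpM2r => //; apply: mul_conjC_ge0.
Qed.

Lemma symmetric_rayleigh_ge (R : realType) n (M : 'M[R]_n) (l : R) :
    M^T = M -> (forall a, eigenvalue M a -> l <= a) ->
  forall v : 'rV[R]_n, l * (v *m v^T) 0 0 <= (v *m M *m v^T) 0 0.
Proof.
move=> symM lP v; rewrite -lerN2 -mulNr.
have -> : - (v *m M *m v^T) 0 0 = (v *m - M *m v^T) 0 0.
  by rewrite mulmxN mulNmx [RHS]mxE.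
apply: symmetric_rayleigh_le => [|a]; first by rewrite linearN /= symM.
case/eigenvalueP=> w wM w0; rewrite lerNr; apply: lP.
by apply/eigenvalueP; exists w; rewrite // scaleNr -wM mulmxN opprK.
Qed.

Section AlphaForm.
Context {R : realType}.

(** The quadratic form of the A_alpha matrix, with the degree term spread over ordered pairs of
    neighbours so that graphs can be compared edge by edge. *)
Definition Aform (a : R) n (G : sgraph n) (x : 'I_n -> R) : R :=
  \sum_i \sum_j (adj G i j)%:R * (a * x i ^+ 2 + (1 - a) * (x i * x j)).

Definition is_eigvec (a l : R) n (G : sgraph n) (x : 'I_n -> R) : Prop :=
  forall i, l * x i = a * (degree G i)%:R * x i
                      + (1 - a) * \sum_j (adj G i j)%:R * x j.

Lemma degreeE n (G : sgraph n) i :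
  (degree G i)%:R = \sum_j (adj G i j)%:R :> R.
Proof.
rewrite /degree -sum1_card natr_sum big_mkcond /=.
by apply: eq_bigr => j _; rewrite inE; case: adj.
Qed.

Lemma mul_Aalpha_mx (a : R) n (G : sgraph n) (v : 'rV[R]_n) i :
  (v *m Aalpha_mx a G) 0 i = a * (degree G i)%:R * v 0 i
                      + (1 - a) * \sum_j (adj G i j)%:R * v 0 j.
Proof.
rewrite mulmxDr -!scalemxAr mul_mx_diag !mxE mulrA mulrAC; congr (_ + _ * _).
by apply: eq_bigr => j _; rewrite !mxE adj_sym mulrC.
Qed.

Lemma Aform_mulmx (a : R) n (G : sgraph n) (x : 'I_n -> R) :
  Aform a G x = (\row_i x i *m Aalpha_mx a G *m (\row_i x i)^T) 0 0.
Proof.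
rewrite mxE; apply: eq_bigr => i _; rewrite mul_Aalpha_mx !mxE degreeE.
rewrite [in RHS]mulr_sumr [in RHS]mulr_suml mulr_sumr -big_split mulr_suml /=.
by apply: eq_bigr => j _; rewrite mxE; ring.
Qed.

Lemma row_normE n (x : 'I_n -> R) :
  (\row_i x i *m (\row_i x i)^T) 0 0 = \sum_i x i ^+ 2.
Proof. by rewrite mxE; apply: eq_bigr => i _; rewrite !mxE expr2. Qed.

Lemma Aform_eigvec (a l : R) n (G : sgraph n) x :
  is_eigvec a l G x -> Aform a G x = l * \sum_i x i ^+ 2.
Proof.
move=> xP; rewrite mulr_sumr; apply: eq_bigr => i _.
rewrite [in RHS]expr2 [in RHS]mulrA xP degreeE.
rewrite [in RHS]mulr_sumr [in RHS]mulr_suml mulr_sumr -big_split mulr_suml /=.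
by apply: eq_bigr => j _; ring.
Qed.

Lemma Aalpha_unit_eigvec (a l : R) n (G : sgraph n) :
  eigenvalue (Aalpha_mx a G) l ->
  exists x : 'I_n -> R, \sum_i x i ^+ 2 = 1 /\ is_eigvec a l G x.
Proof.
case/eigenvalueP=> v vM v0; pose N := \sum_i (v 0 i) ^+ 2.
have N0 : 0 < N.
  rewrite lt_def sumr_ge0 ?andbT => [|i _]; last exact: sqr_ge0.
  apply: contraNN v0; rewrite psumr_eq0 => [/allP h|i _]; last exact: sqr_ge0.
  apply/eqP/rowP=> j; rewrite mxE; apply/eqP; rewrite -sqrf_eq0.
  exact: h (mem_index_enum _).
exists (fun i => (Num.sqrt N)^-1 * v 0 i); split.
  under eq_bigr => i _ do rewrite exprMn.
  by rewrite -mulr_sumr exprVn sqr_sqrtr ?ltW // mulVf // gt_eqF.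
move=> i; rewrite mulrCA.
have -> : l * v 0 i = (v *m Aalpha_mx a G) 0 i by rewrite vM mxE.
rewrite mul_Aalpha_mx; under [in RHS]eq_bigr => j _ do rewrite mulrCA.
by rewrite -mulr_sumr; ring.
Qed.

Lemma lambda_max_eigvec (a : R) n (G : sgraph n) : (0 < n)%N ->
  exists x : 'I_n -> R,
    \sum_i x i ^+ 2 = 1 /\ is_eigvec a (lambda_max a G) G x.
Proof.
move=> n0; apply: Aalpha_unit_eigvec.
by have [] := max_eigenvalueP n0 (Aalpha_mx_sym a G).
Qed.

Lemma lambda_min_eigvec (a : R) n (G : sgraph n) : (0 < n)%N ->
  exists x : 'I_n -> R,
    \sum_i x i ^+ 2 = 1 /\ is_eigvec a (lambda_min a G) G x.
Proof.
move=> n0; apply: Aalpha_unit_eigvec.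
by have [] := min_eigenvalueP n0 (Aalpha_mx_sym a G).
Qed.

Lemma Aform_le_lambda_max (a : R) n (G : sgraph n) x : (0 < n)%N ->
  Aform a G x <= lambda_max a G * \sum_i x i ^+ 2.
Proof.
move=> n0; rewrite Aform_mulmx -row_normE.
apply: symmetric_rayleigh_le; first exact: Aalpha_mx_sym.
by have [] := max_eigenvalueP n0 (Aalpha_mx_sym a G).
Qed.

Lemma lambda_min_le_Aform (a : R) n (G : sgraph n) x : (0 < n)%N ->
  lambda_min a G * (\sum_i x i ^+ 2) <= Aform a G x.
Proof.
move=> n0; rewrite Aform_mulmx -row_normE.
apply: symmetric_rayleigh_ge; first exact: Aalpha_mx_sym.
by have [] := min_eigenvalueP n0 (Aalpha_mx_sym a G).
Qed.

Lemma Aform_sym (a : R) n (G : sgraph n) x :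
  Aform a G x = \sum_i \sum_j (adj G i j)%:R *
    (a * ((x i ^+ 2 + x j ^+ 2) / 2) + (1 - a) * (x i * x j)).
Proof.
have E : Aform a G x =
    \sum_i \sum_j (adj G i j)%:R * (a * x j ^+ 2 + (1 - a) * (x i * x j)).
  rewrite /Aform exchange_big; apply: eq_bigr => i _; apply: eq_bigr => j _.
  by rewrite adj_sym [x j * _]mulrC.
suff : Aform a G x + Aform a G x = 2 * \sum_i \sum_j (adj G i j)%:R *
    (a * ((x i ^+ 2 + x j ^+ 2) / 2) + (1 - a) * (x i * x j)) by lra.
rewrite {2}E /Aform -big_split mulr_sumr; apply: eq_bigr => i _ /=.
by rewrite -big_split mulr_sumr; apply: eq_bigr => j _ /=; field.
Qed.

(** On each edge the two sides differ by a nonnegative multiple of [(x i - x j) ^+ 2]. *)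
Lemma Aform_le_degree (a : R) n (G : sgraph n) x : a <= 1 ->
  Aform a G x <= \sum_i (degree G i)%:R * x i ^+ 2.
Proof.
move=> a1.
have -> : \sum_i (degree G i)%:R * x i ^+ 2 = Aform 1 G x.
  apply: eq_bigr => i _; rewrite degreeE mulr_suml; apply: eq_bigr => j _; ring.
rewrite !Aform_sym; apply: ler_sum => i _; apply: ler_sum => j _.
apply: ler_wpM2l => //.
have : 0 <= (1 - a) * (x i - x j) ^+ 2 by rewrite mulr_ge0 ?sqr_ge0 ?subr_ge0.
by lra.
Qed.

(** For [a >= 1 / 2] the form dominates a multiple of the signless Laplacian form: each ordered pair
    leaves the excess [(a - 1 / 2) * (x i ^+ 2 + x j ^+ 2)]. *)
Lemma Aform_ge_signless (a : R) n (G : sgraph n) x : 2^-1 <= a -> a <= 1 ->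
  (1 - a) / 2 * (\sum_i \sum_j (adj G i j)%:R * (x i + x j) ^+ 2) <= Aform a G x.
Proof.
move=> a2 a1; rewrite Aform_sym mulr_sumr; apply: ler_sum => i _.
rewrite mulr_sumr; apply: ler_sum => j _; rewrite mulrCA.
apply: ler_wpM2l => //.
have : 0 <= (a - 2^-1) * (x i ^+ 2 + x j ^+ 2).
  by apply: mulr_ge0; rewrite ?subr_ge0 // addr_ge0 ?sqr_ge0.
by lra.
Qed.

(** Lagrange's identity writes twice the difference of the two sides as a sum of squares. *)
Lemma CauchySchwarz_sum (I : finType) (P : pred I) (a b : I -> R) :
  (\sum_(i | P i) a i * b i) ^+ 2 <=
    (\sum_(i | P i) a i ^+ 2) * \sum_(i | P i) b i ^+ 2.
Proof.
have h : 0 <= \sum_(i | P i) \sum_(j | P j) (a i * b j - a j * b i) ^+ 2.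
  by apply: sumr_ge0 => i _; apply: sumr_ge0 => j _; apply: sqr_ge0.
suff E : \sum_(i | P i) \sum_(j | P j) (a i * b j - a j * b i) ^+ 2 =
   2 * ((\sum_(i | P i) a i ^+ 2) * \sum_(i | P i) b i ^+ 2)
   - 2 * (\sum_(i | P i) a i * b i) ^+ 2 by move: h; rewrite E; lra.
have E1 : (\sum_(i | P i) a i ^+ 2) * (\sum_(i | P i) b i ^+ 2) =
    \sum_(i | P i) \sum_(j | P j) a i ^+ 2 * b j ^+ 2.
  by rewrite mulr_suml; apply: eq_bigr => i _; rewrite mulr_sumr.
have E2 : (\sum_(i | P i) a i ^+ 2) * (\sum_(i | P i) b i ^+ 2) =
    \sum_(i | P i) \sum_(j | P j) a j ^+ 2 * b i ^+ 2.
  by rewrite E1 exchange_big.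
have E3 : (\sum_(i | P i) a i * b i) ^+ 2 =
    \sum_(i | P i) \sum_(j | P j) (a i * b i) * (a j * b j).
  by rewrite expr2 mulr_suml; apply: eq_bigr => i _; rewrite mulr_sumr.
rewrite [2 * (_ * _)]mulr_natl mulr2n {1}E1 E2 E3 mulr_sumr -big_split -sumrB /=.
apply: eq_bigr => i _; rewrite mulr_sumr -big_split -sumrB /=.
by apply: eq_bigr => j _; ring.
Qed.

(** The Frobenius norm bound: Cauchy-Schwarz over ordered pairs, where a 0/1 matrix has squared norm
    equal to its number of ones. *)
Lemma rel_form_le n (e : rel 'I_n) (x : 'I_n -> R) :
  (\sum_i \sum_j (e i j)%:R * (x i * x j)) ^+ 2 <=
    (\sum_i \sum_j (e i j)%:R) * (\sum_i x i ^+ 2) ^+ 2.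
Proof.
rewrite !pair_bigA /=; apply: le_trans (CauchySchwarz_sum _ _ _) _.
rewrite le_eqVlt; apply/orP; left; apply/eqP; congr (_ * _).
  by apply: eq_bigr => p _; case: (e _ _); rewrite ?expr1n ?expr0n.
rewrite expr2 mulr_suml -(pair_bigA _ (fun i j => (x i * x j) ^+ 2)) /=.
by apply: eq_bigr => i _; rewrite mulr_sumr; apply: eq_bigr => j _; rewrite exprMn.
Qed.

End AlphaForm.

(** * Nearly complete graphs *)

(** If no edge left [A], then [A] would be closed under adjacency and hence under connectivity. *)
Lemma connected_crossing n (G : sgraph n) (A : {set 'I_n}) a b :
  graph_connected G -> a \in A -> b \notin A ->
  exists u w, [/\ u \in A, w \notin A & adj G u w].
Proof.
move=> cG aA bA.
have [/existsP[u /existsP[w /and3P[uA wA uw]]]|] :=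
  boolP [exists u, exists w, [&& u \in A, w \notin A & adj G u w]].
  by exists u, w.
rewrite negb_exists => /forallP h.
have clA : closed (adj G) A.
  apply: intro_closed => [|u w uw uA].
    by move=> u w; apply/idP/idP => _; apply: cG.
  have := h u; rewrite negb_exists => /forallP/(_ w).
  by rewrite uA uw andbT negbK.
by have := closed_connect clA (cG a b); rewrite aA (negbTE bA).
Qed.

Section Estimates.
Context {R : realType}.

Definition coadj n (G : sgraph n) : rel 'I_n := fun i j => (i != j) && ~~ adj G i j.

(** Ordered pairs are counted, so this is twice the number of missing edges. *)
Definition nonedges n (G : sgraph n) : R := \sum_i \sum_j (coadj G i j)%:R.

Lemma sum_neq n (i : 'I_n) : \sum_j (j != i)%:R = n%:R - 1 :> R.
Proof.
have : \sum_(j < n) 1 = n%:R :> R by rewrite sumr_const card_ord.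
rewrite (bigD1 i) //= => <-; rewrite addrAC subrr add0r [RHS]big_mkcond /=.
by apply: eq_bigr => j _; case: eqP.
Qed.

Lemma codegreeE n (G : sgraph n) i :
  \sum_j (coadj G i j)%:R = n%:R - 1 - (degree G i)%:R :> R.
Proof.
rewrite -(sum_neq i) degreeE -sumrB; apply: eq_bigr => j _.
rewrite /coadj eq_sym; case: eqP => [->|_]; first by rewrite adj_irr subrr.
by case: adj; rewrite /= ?subrr ?subr0.
Qed.

Lemma degree_le n (G : sgraph n) i : (degree G i)%:R <= n%:R - 1 :> R.
Proof. by rewrite -subr_ge0 -(codegreeE G) sumr_ge0. Qed.

Lemma nonedgesE n (G : sgraph n) :
  nonedges G = \sum_i (n%:R - 1 - (degree G i)%:R).
Proof. by apply: eq_bigr => i _; rewrite codegreeE. Qed.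

Lemma Aform_split (a : R) n (G : sgraph n) x :
  Aform a G x = a * (\sum_i (degree G i)%:R * x i ^+ 2)
              + (1 - a) * \sum_i \sum_j (adj G i j)%:R * (x i * x j).
Proof.
rewrite !mulr_sumr -big_split; apply: eq_bigr => i _ /=.
rewrite degreeE mulr_suml !mulr_sumr -big_split.
by apply: eq_bigr => j _ /=; ring.
Qed.

Lemma sqr_diag_sum n (x : 'I_n -> R) i :
  x i ^+ 2 = \sum_j (j == i)%:R * (x i * x j).
Proof.
rewrite (bigD1 i) //= eqxx mul1r -expr2 big1 ?addr0 // => j /negbTE->.
by rewrite mul0r.
Qed.

(** The adjacency matrix is the all-ones matrix minus the identity minus the adjacency matrix of the
    complement. *)
Lemma adj_form_coadj n (G : sgraph n) (x : 'I_n -> R) :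
  \sum_i \sum_j (adj G i j)%:R * (x i * x j) =
  (\sum_i x i) ^+ 2 - \sum_i x i ^+ 2
  - \sum_i \sum_j (coadj G i j)%:R * (x i * x j).
Proof.
rewrite expr2 mulr_suml -!sumrB; apply: eq_bigr => i _; rewrite mulr_sumr.
rewrite sqr_diag_sum -!sumrB; apply: eq_bigr => j _; rewrite /coadj eq_sym.
by case: eqP => [->|_]; rewrite ?adj_irr /=; [ring|case: adj => /=; ring].
Qed.

(** The degree part is at most [n - 1], so the adjacency form at the eigenvector is at least
    [n - 1 - 2 / (1 - a)]. Its square is at most the number of ordered adjacent pairs,
    [n * (n - 1) - nonedges G]. *)
Lemma nonedges_le (a : R) n (G : sgraph n) :
    0 <= a < 1 -> 1 + 2 / (1 - a) <= n%:R -> n%:R - 3 <= lambda_max a G ->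
  nonedges G <= (1 + 4 / (1 - a)) * n%:R.
Proof.
case/andP=> a0 a1 nlarge lmax; set N : R := n%:R in nlarge lmax *.
have b0 : 0 < 1 - a by rewrite subr_gt0.
have n0 : (0 < n)%N.
  rewrite -(ltr_nat R); apply: lt_le_trans nlarge.
  by rewrite ltr_pwDl // divr_ge0 // ltW.
have [x [x1 xP]] := lambda_max_eigvec a G n0.
have := Aform_eigvec xP; rewrite x1 mulr1 Aform_split.
set D := (X in a * X + _); set A := \sum_i \sum_j _ => E.
have Dle : D <= N - 1.
  rewrite -[leRHS]mulr1 -[X in _ * X]x1 mulr_sumr; apply: ler_sum => i _.
  by apply: ler_wpM2r; rewrite ?sqr_ge0 ?degree_le.
have Ale : A ^+ 2 <= N * (N - 1) - nonedges G.
  apply: le_trans (rel_form_le (adj G) x) _; rewrite x1 expr1n mulr1 nonedgesE.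
  under eq_bigr do rewrite -degreeE.
  rewrite sumrB sumr_const card_ord -mulr_natl -/N; lra.
pose b := 2 / (1 - a); have bE : (1 - a) * b = 2 by rewrite /b; field; rewrite gt_eqF.
have Age : N - 1 - b <= A.
  rewrite -(ler_pM2l b0); move: (ler_wpM2l a0 Dle); lra.
have -> : 4 / (1 - a) = 2 * b by rewrite /b; field; rewrite gt_eqF.
have nb : 0 <= N - 1 - b by move: nlarge; rewrite -/b; lra.
have A2 : (N - 1 - b) ^+ 2 <= A ^+ 2 by rewrite lerXn2r ?nnegrE // (le_trans nb).
have b0' : 0 <= b by rewrite divr_ge0 // ltW.
have b2 : 0 <= b ^+ 2 by rewrite sqr_ge0.
have := nb; nra.
Qed.

Lemma adj_form_bounds (C t : R) n (G : sgraph n) (x : 'I_n -> R) :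
    1 <= C -> 0 <= t -> nonedges G <= C * t ^+ 2 ->
  - (1 + C * t) * (\sum_i x i ^+ 2)
    <= \sum_i \sum_j (adj G i j)%:R * (x i * x j)
    <= (\sum_i x i) ^+ 2 + C * t * \sum_i x i ^+ 2.
Proof.
move=> C1 t0 hne; rewrite adj_form_coadj.
set S := \sum_i x i ^+ 2; set B := \sum_i \sum_j _.
have S0 : 0 <= S by apply: sumr_ge0 => i _; apply: sqr_ge0.
have Ct0 : 0 <= C * t * S by rewrite !mulr_ge0 //; lra.
have : `|B| <= C * t * S.
  rewrite -ler_sqr ?nnegrE // real_normK ?num_real //.
  apply: le_trans (rel_form_le (coadj G) x) _; rewrite !exprMn; apply: ler_wpM2r.
    exact: sqr_ge0.
  apply: le_trans hne _; apply: ler_wpM2r; first exact: sqr_ge0.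
  (* Here [C <= C ^+ 2], which spares a square root of [C] in the bound. *)
  by rewrite expr2 ler_peMl //; lra.
rewrite ler_norml => /andP[B1 B2].
have : 0 <= (\sum_i x i) ^+ 2 by rewrite sqr_ge0.
by move=> h; apply/andP; split; lra.
Qed.

(** The adjacency form is never below [- (1 + C * t)], so a bounded [m] leaves only order [t] for
    the degree part. *)
Lemma lambda_min_degree_mass (g m C t : R) n (G : sgraph n) (z : 'I_n -> R) :
    0 <= g <= 1 -> 1 <= C -> 0 <= t -> nonedges G <= C * t ^+ 2 ->
    \sum_i z i ^+ 2 = 1 -> is_eigvec g m G z ->
  g * (\sum_i (degree G i)%:R * z i ^+ 2) <= m + 1 + C * t.
Proof.
case/andP=> g0 g1 C1 t0 hne z1 zP.
have := adj_form_bounds z C1 t0 hne; have := Aform_eigvec zP.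
rewrite Aform_split z1 !mulr1; set A := \sum_i \sum_j _ => E /andP[A1 _].
have h : 0 <= C * t by rewrite mulr_ge0 //; lra.
have : 0 <= (1 - g) * (A + (1 + C * t)) by rewrite mulr_ge0 //; lra.
have : 0 <= g * (1 + C * t) by rewrite mulr_ge0 //; lra.
by lra.
Qed.

(** * Vertices of low degree and their effect on the eigenvalues *)

Definition low_vertices (eta : R) n (G : sgraph n) : {set 'I_n} :=
  [set i | (degree G i)%:R < eta * n%:R].

(** Each low vertex has at least [n - 1 - n / 2 >= n / 4] non-neighbours. The resulting bound does
    not depend on [eta]. *)
Lemma low_vertices_card (eta C : R) n (G : sgraph n) :
    eta <= 1 / 2 -> 4 <= n%:R :> R -> nonedges G <= C * n%:R ->
  #|low_vertices eta G|%:R <= 4 * C.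
Proof.
move=> eta2 n4 hne.
have h : #|low_vertices eta G|%:R * (n%:R / 4) <= nonedges G.
  rewrite nonedgesE mulr_natl -sumr_const big_mkcond /=; apply: ler_sum => i _.
  have := degree_le G i; rewrite inE; case: ifP => [di|_]; last by lra.
  have : eta * n%:R <= 1 / 2 * n%:R by rewrite ler_wpM2r.
  by lra.
have n0 : 0 < n%:R / 4 :> R by lra.
by rewrite -(ler_pM2r n0); lra.
Qed.

Lemma high_vertices_mass (eta D : R) n (G : sgraph n) (z : 'I_n -> R) :
    0 < eta -> (0 < n)%N ->
    \sum_i (degree G i)%:R * z i ^+ 2 <= D ->
  \sum_(i | i \notin low_vertices eta G) z i ^+ 2 <= D / (eta * n%:R).
Proof.
move=> eta0 n0 hD; rewrite ler_pdivlMr; last by rewrite mulr_gt0 ?ltr0n.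
apply: le_trans hD; rewrite mulr_suml big_mkcond /=; apply: ler_sum => i _.
rewrite inE -leNgt; case: ifP => [di|_]; last by rewrite mulr_ge0 ?sqr_ge0.
by rewrite mulrC ler_wpM2r ?sqr_ge0.
Qed.

Lemma nbsum_sqr_le n (G : sgraph n) i (x : 'I_n -> R) :
  (\sum_j (adj G i j)%:R * x j) ^+ 2 <= (degree G i)%:R * \sum_(j | adj G i j) x j ^+ 2.
Proof.
have E : \sum_j (adj G i j)%:R * x j = \sum_(j | adj G i j) 1 * x j.
  by rewrite [RHS]big_mkcond; apply: eq_bigr => j _; case: adj; rewrite ?mul1r ?mul0r.
rewrite E; apply: le_trans (CauchySchwarz_sum _ _ _) _.
rewrite degreeE le_eqVlt; apply/orP; left; apply/eqP; congr (_ * _).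
rewrite big_mkcond; apply: eq_bigr => j _.
by case: adj; rewrite ?expr1n.
Qed.

(** In the eigenvalue equation at [i], the coefficient [l - a * degree] is at least
    [(1 - a) * 3 / 4 * n], while the neighbour sum has square at most [n]; this gives
    [16 / (9 * n)]. *)
Lemma lambda_max_entry_le (a l : R) n (G : sgraph n) (x : 'I_n -> R) i :
    0 <= a < 1 -> 4 * (1 + 2 / (1 - a)) <= n%:R -> n%:R - 3 <= l ->
    \sum_i x i ^+ 2 = 1 -> is_eigvec a l G x ->
  x i ^+ 2 <= 2 / n%:R.
Proof.
case/andP=> a0 a1 nlarge hl x1 xP; set N : R := n%:R in nlarge hl *.
have b0 : 0 < 1 - a by rewrite subr_gt0.
pose b := 2 / (1 - a).
have bE : (1 - a) * b = 2 by rewrite /b; field; rewrite gt_eqF.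
have b0' : 0 <= b by rewrite divr_ge0 // ltW.
rewrite -/b in nlarge; have N0 : 0 < N by lra.
have dle : (degree G i)%:R <= N - 1 := degree_le G i.
have ad : a * (degree G i)%:R <= a * (N - 1) by rewrite ler_wpM2l.
have c1 : (1 - a) * (3 / 4 * N) <= l - a * (degree G i)%:R.
  have : (1 - a) * (3 / 4 * N) <= (1 - a) * (N - 1 - b) by rewrite ler_pM2l //; lra.
  by lra.
have c2 : ((1 - a) * (3 / 4 * N)) ^+ 2 <= (l - a * (degree G i)%:R) ^+ 2.
  have h : 0 <= (1 - a) * (3 / 4 * N) by rewrite mulr_ge0 //; lra.
  by rewrite lerXn2r ?nnegrE // (le_trans h).
have c3 : ((l - a * (degree G i)%:R) * x i) ^+ 2 <= (1 - a) ^+ 2 * N.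
  have -> : (l - a * (degree G i)%:R) * x i = (1 - a) * \sum_j (adj G i j)%:R * x j.
    by rewrite mulrBl xP; ring.
  rewrite exprMn ler_wpM2l ?sqr_ge0 //; apply: le_trans (nbsum_sqr_le _ _ _) _.
  rewrite -[N]mulr1; apply: ler_pM => //; first by apply: sumr_ge0 => j _; apply: sqr_ge0.
    by lra.
  rewrite -x1 big_mkcond; apply: ler_sum => j _; case: ifP => // _; exact: sqr_ge0.
have c4 : ((1 - a) * (3 / 4 * N)) ^+ 2 * x i ^+ 2 <= (1 - a) ^+ 2 * N.
  by apply: le_trans c3; rewrite [leRHS]exprMn ler_wpM2r ?sqr_ge0.
have c5 : (1 - a) ^+ 2 * (N * (9 / 16 * N * x i ^+ 2)) <= (1 - a) ^+ 2 * (N * 1).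
  by move: c4; lra.
rewrite ler_pM2l ?exprn_gt0 // ler_pM2l // in c5.
by rewrite ler_pdivlMr //; lra.
Qed.

(** A vertex outside [T] has degree at most [n - 1 - #|T|] plus its number of neighbours in [T]. The
    degrees of [T] enter once for its own vertices and once for their neighbours, whence the factor
    2. *)
Lemma degree_mass_le (B : R) n (G : sgraph n) (x : 'I_n -> R) (T : {set 'I_n}) :
    #|T|%:R <= n%:R - 1 :> R ->
    \sum_i x i ^+ 2 = 1 -> (forall i, x i ^+ 2 <= B) ->
  \sum_i (degree G i)%:R * x i ^+ 2 <=
    n%:R - 1 - #|T|%:R + 2 * B * \sum_(v in T) (degree G v)%:R.
Proof.
move=> Tn x1 xB.
have dle i : (degree G i)%:R <= (n%:R - 1 - #|T|%:R)
    + ((i \in T)%:R * (degree G i)%:R + \sum_(v in T) (adj G i v)%:R) :> R.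
  have s0 : 0 <= \sum_(v in T) (adj G i v)%:R :> R by apply: sumr_ge0.
  case: (boolP (i \in T)) => [_|iT]; first by rewrite mul1r; lra.
  rewrite mul0r add0r.
  have : \sum_(v in T) (1 - (adj G i v)%:R) <= \sum_j (coadj G i j)%:R :> R.
    rewrite big_mkcond; apply: ler_sum => j _; case: ifP => // jT.
    have ij : i != j by apply: contraNneq iT => ->.
    by rewrite /coadj ij; case: adj; rewrite ?subrr ?subr0.
  by rewrite sumrB sumr_const codegreeE; lra.
have B0 (i : 'I_n) : 0 <= B by apply: le_trans (sqr_ge0 (x i)) (xB i).
apply: (@le_trans _ _ (\sum_i ((n%:R - 1 - #|T|%:R) * x i ^+ 2
    + ((i \in T)%:R * (degree G i)%:R * B + \sum_(v in T) (adj G i v)%:R * B)))).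
  apply: ler_sum => i _; apply: le_trans (ler_wpM2r (sqr_ge0 _) (dle i)) _.
  rewrite mulrDl lerD2l mulrDl; apply: lerD.
    by apply: ler_wpM2l => //; apply: mulr_ge0.
  by rewrite -mulr_suml; apply: ler_wpM2l => //; apply: sumr_ge0.
rewrite big_split -mulr_sumr x1 mulr1 lerD2l big_split /=.
rewrite -mulr_suml exchange_big /=.
have -> : \sum_(v in T) \sum_i (adj G i v)%:R * B = \sum_(v in T) (degree G v)%:R * B.
  apply: eq_bigr => v _; rewrite degreeE mulr_suml.
  by apply: eq_bigr => i _; rewrite adj_sym.
rewrite -mulr_suml.
have -> : \sum_i (i \in T)%:R * (degree G i)%:R = \sum_(v in T) (degree G v)%:R :> R.
  rewrite [RHS]big_mkcond; apply: eq_bigr => i _.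
  by case: ifP; rewrite ?mul1r ?mul0r.
by clear B0; lra.
Qed.

(** Each vertex of [T] costs almost 1 when its degree is small against [n]; the entry bound [2 / n]
    serves as [B]. *)
Lemma lambda_max_le_low (a : R) n (G : sgraph n) (T : {set 'I_n}) :
    0 <= a < 1 -> 4 * (1 + 2 / (1 - a)) <= n%:R ->
    n%:R - 3 <= lambda_max a G -> #|T|%:R <= n%:R - 1 :> R ->
  lambda_max a G <=
    n%:R - 1 - #|T|%:R + 4 / n%:R * \sum_(v in T) (degree G v)%:R.
Proof.
move=> ha nlarge hl Tn; have /andP[a0 a1] := ha.
have n0 : (0 < n)%N.
  rewrite -(ltr_nat R); apply: lt_le_trans nlarge; rewrite mulr_gt0 //.
  by rewrite ltr_pwDl // divr_ge0 // subr_ge0 ltW.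
have [x [x1 xP]] := lambda_max_eigvec a G n0.
have -> : 4 / n%:R = 2 * (2 / n%:R) :> R by lra.
apply: le_trans (degree_mass_le G Tn x1 _) => [|i]; last exact: lambda_max_entry_le xP.
have := Aform_eigvec xP; rewrite x1 mulr1 => <-.
by apply: Aform_le_degree; rewrite ltW.
Qed.

Lemma lambda_max_le (a : R) n (G : sgraph n) :
  a <= 1 -> (0 < n)%N -> lambda_max a G <= n%:R - 1.
Proof.
move=> a1 n0; have [x [x1 xP]] := lambda_max_eigvec a G n0.
have := Aform_eigvec xP; rewrite x1 mulr1 => <-.
apply: le_trans (Aform_le_degree G x a1) _.
rewrite -[leRHS]mulr1 -[X in _ * X]x1 mulr_sumr; apply: ler_sum => i _.
by rewrite ler_wpM2r ?sqr_ge0 ?degree_le.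
Qed.

Lemma lambda_min_ge_signless (g : R) n (G : sgraph n) (z : 'I_n -> R) (m : R) i j :
    2^-1 <= g -> g <= 1 -> \sum_i z i ^+ 2 = 1 -> is_eigvec g m G z ->
  (1 - g) / 2 * ((adj G i j)%:R * (z i + z j) ^+ 2) <= m.
Proof.
move=> g2 g1 z1 zP; have := Aform_eigvec zP; rewrite z1 mulr1 => <-.
apply: le_trans (Aform_ge_signless G z g2 g1).
apply: ler_wpM2l; first by lra.
have nn u w : 0 <= (adj G u w)%:R * (z u + z w) ^+ 2 by rewrite mulr_ge0 ?sqr_ge0.
rewrite (bigD1 i) //= (bigD1 j) //= -addrA lerDl addr_ge0 ?sumr_ge0 // => u _.
exact: sumr_ge0.
Qed.

(** The superlevel set of [f] at [s + k * r] starts inside [L] and loses a vertex whenever [k] grows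
    by one, because some edge leaves it; after [#|L|] steps it is empty. *)
Lemma connected_propagate n (G : sgraph n) (f : 'I_n -> R) (L : {set 'I_n}) (s r : R) h :
    graph_connected G -> 0 <= r -> h \notin L ->
    (forall i, i \notin L -> f i <= s) ->
    (forall i j, adj G i j -> f i <= f j + r) ->
  forall i, f i <= s + #|L|%:R * r.
Proof.
move=> cG r0 hL fL fr.
have card_le (k : nat) : (#|[set i | (s + k%:R * r < f i)%R]| <= #|L| - k)%N.
  elim: k => [|k IH].
    rewrite subn0 subset_leq_card //; apply/subsetP=> i; rewrite inE mul0r addr0.
    by apply: contraTT => /fL; rewrite -leNgt.
  set A := finset _ in IH *.
  have sub : [set i | s + k.+1%:R * r < f i] \subset A.
    apply/subsetP=> i; rewrite !inE => /(le_lt_trans _); apply.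
    by rewrite lerD2l ler_wpM2r // ler_nat.
  have [A0|[a aA]] := set_0Vmem A.
    by move: sub; rewrite A0 subset0 => /eqP->; rewrite cards0.
  have hA : h \notin A.
    rewrite inE -leNgt (le_trans (fL _ hL)) // lerDl mulr_ge0 //.
  have [u [w [uA wA uw]]] := connected_crossing cG aA hA.
  have lt : [set i | s + k.+1%:R * r < f i] \proper A.
    rewrite properE sub; apply/subsetPn; exists u => //.
    rewrite inE -leNgt (le_trans (fr _ _ uw)) //.
    by move: wA; rewrite inE -leNgt -natr1; lra.
  by move: (proper_card lt) IH; lia.
move=> i; have := card_le #|L|; rewrite subnn leqn0 cards_eq0 => /eqP/setP/(_ i).
by rewrite !inE ltNge => /negbFE.
Qed.

End Estimates.

(** * The kite *)

Lemma kite_maxl m (j : 'I_m.+2) : adj (kite m.+2) ord_max j = (j == ord0).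
Proof.
rewrite /= /kite_rel /= eqxx ltnn /= -!val_eqE /=.
by case: (nat_of_ord j) => [|k]; rewrite ?andbF.
Qed.

Lemma kite_clique m (i j : 'I_m.+1) :
  i != ord_max -> j != ord_max -> adj (kite m.+1) i j = (i != j).
Proof.
move=> im jm; rewrite /= /kite_rel /=.
have lt (k : 'I_m.+1) : k != ord_max -> (k < m)%N.
  by rewrite -val_eqE /= => km; have := ltn_ord k; lia.
by rewrite (lt _ im) (lt _ jm) /= andbT.
Qed.

Lemma kite_connected m : graph_connected (kite m.+2).
Proof.
have c0 i : connect (adj (kite m.+2)) ord0 i.
  have [->|i0] := eqVneq i ord0; first exact: connect0.
  apply: connect1; have [->|im] := eqVneq i ord_max.
    by rewrite adj_sym kite_maxl.
  by rewrite kite_clique // eq_sym.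
move=> i j; apply: connect_trans (c0 j).
by rewrite (sym_connect_sym (@adj_sym _ _)).
Qed.

(** The pendant vertex [v] goes to the last vertex and its neighbour [w] to vertex 0. Edges at [v]
    then match exactly, so every extra kite edge avoids [v]. *)
Lemma pendant_embeds_kite m (G : sgraph m.+2) v w :
    adj G v w -> (forall u, adj G v u -> u = w) ->
  exists2 s : {perm 'I_m.+2},
    forall i j, adj G i j -> adj (kite m.+2) (s i) (s j) &
    forall i j, adj (kite m.+2) (s i) (s j) -> ~~ adj G i j -> i != v /\ j != v.
Proof.
move=> vw vP; have wv : w != v by apply: contraTneq vw => ->; rewrite adj_irr.
(* [w'] is where the first transposition puts [w], which may itself have been [ord_max]. *)
pose w' := tperm v ord_max w; pose s := (tperm v ord_max * tperm w' ord0)%g.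
have sv : s v = ord_max.
  rewrite permM tpermL tpermD // /w'.
  by rewrite -[X in _ != X](tpermL v) (inj_eq perm_inj).
have sw : s w = ord0 by rewrite permM tpermL.
have neq i : i != v -> s i != ord_max by rewrite -sv (inj_eq perm_inj).
have kv j : adj (kite m.+2) (s v) (s j) = adj G v j.
  rewrite sv kite_maxl -sw (inj_eq perm_inj).
  by apply/eqP/idP => [->|/vP].
exists s => i j.
  have [->|iv] := eqVneq i v; first by rewrite kv.
  have [->|jv] := eqVneq j v; first by rewrite adj_sym [adj (kite _) _ _]adj_sym kv.
  rewrite kite_clique ?neq // (inj_eq perm_inj) => ij.
  by apply: contraTneq ij => ->; rewrite adj_irr.
have [->|iv] := eqVneq i v; first by rewrite kv => ->.
by have [->|jv] := eqVneq j v; first by rewrite adj_sym kv adj_sym => ->.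
Qed.

(** * Test vectors for the kite and transport along embeddings *)

Section Comparison.
Context {R : realType}.

(** The test vector is the indicator of [v]. *)
Lemma lambda_min_le_degree (g : R) n (G : sgraph n) v :
  lambda_min g G <= g * (degree G v)%:R.
Proof.
have n0 : (0 < n)%N by case: n G v => // ? [].
have := lambda_min_le_Aform g G (fun i => (i == v)%:R) n0.
have -> : \sum_i (i == v)%:R ^+ 2 = 1 :> R.
  rewrite (bigD1 v) //= eqxx expr1n big1 ?addr0 // => i /negbTE->.
  by rewrite expr0n.
rewrite mulr1 => /le_trans; apply; rewrite le_eqVlt; apply/orP; left; apply/eqP.
rewrite /Aform (bigD1 v) //= [X in _ + X]big1 => [|i /negbTE->]; last first.
  by apply: big1 => j _; rewrite expr0n /= mul0r !mulr0 addr0 mulr0.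
rewrite addr0 degreeE mulr_sumr; apply: eq_bigr => j _; rewrite eqxx expr1n.
by case: eqP => [->|_]; rewrite ?adj_irr /=; ring.
Qed.

Lemma lambda_min_kite (g : R) m : lambda_min g (kite m.+2) <= g.
Proof.
apply: le_trans (lambda_min_le_degree _ _ ord_max) _.
suff -> : degree (kite m.+2) ord_max = 1%N by rewrite mulr1.
rewrite /degree -[RHS](cards1 (ord0 : 'I_m.+2)); apply: eq_card => j.
by rewrite !inE kite_maxl.
Qed.

(** The test vector is the indicator of the clique on [m.+1] vertices; the pendant edge can only add
    to the form. *)
Lemma lambda_max_kite (a : R) m : 0 <= a <= 1 ->
  m%:R <= lambda_max a (kite m.+2).
Proof.
case/andP=> a0 a1; pose x (i : 'I_m.+2) : R := (i != ord_max)%:R.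
have xx i : x i ^+ 2 = x i by rewrite /x; case: eqP; rewrite ?expr0n ?expr1n.
have sx : \sum_i x i = m.+1%:R.
  by rewrite /x sum_neq -[in LHS]natr1 addrK.
have sx2 : \sum_i x i ^+ 2 = m.+1%:R by rewrite -sx; apply: eq_bigr => i _.
have := Aform_le_lambda_max a (kite m.+2) x isT; rewrite sx2.
have Q : m.+1%:R ^+ 2 - m.+1%:R <= Aform a (kite m.+2) x.
  rewrite -{1}sx -sx2 expr2 mulr_suml -sumrB; apply: ler_sum => i _.
  rewrite mulr_sumr.
  rewrite [X in _ - X]sqr_diag_sum -sumrB; apply: ler_sum => j _; rewrite xx /x.
  have h0 u w : 0 <= (adj (kite m.+2) u w)%:R * a by rewrite mulr_ge0.
  case: (eqVneq i ord_max) => [->|im]; first by rewrite /=; lra.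
  case: (eqVneq j ord_max) => [->|jm]; first by have := h0 i ord_max; rewrite /=; lra.
  rewrite kite_clique // [j == i]eq_sym; case: eqP => _ /=; lra.
move=> /(le_trans Q); have -> : m.+1%:R ^+ 2 - m.+1%:R = m%:R * m.+1%:R :> R.
  by rewrite -natr1; ring.
by rewrite ler_pM2r.
Qed.

Lemma Aform_reindex (a : R) n (H : sgraph n) (s : {perm 'I_n}) (x : 'I_n -> R) :
  Aform a H (fun i => x ((s^-1)%g i)) =
  \sum_i \sum_j (adj H (s i) (s j))%:R * (a * x i ^+ 2 + (1 - a) * (x i * x j)).
Proof.
rewrite /Aform (reindex_inj (@perm_inj _ s)); apply: eq_bigr => i _ /=.
rewrite (reindex_inj (@perm_inj _ s)); apply: eq_bigr => j _ /=.
by rewrite !permK.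
Qed.

Lemma sqr_sum_reindex n (s : {perm 'I_n}) (x : 'I_n -> R) :
  \sum_i x ((s^-1)%g i) ^+ 2 = \sum_i x i ^+ 2.
Proof.
rewrite (reindex_inj (@perm_inj _ s)); apply: eq_bigr => i _ /=.
by rewrite permK.
Qed.

Lemma graph_iso_lambda_max_le (a : R) n (G H : sgraph n) : (0 < n)%N ->
  graph_iso G H -> lambda_max a G <= lambda_max a H.
Proof.
move=> n0 [s sP]; have [x [x1 xP]] := lambda_max_eigvec a G n0.
have := Aform_le_lambda_max a H (fun i => x ((s^-1)%g i)) n0.
rewrite sqr_sum_reindex Aform_reindex x1 mulr1; apply: le_trans.
have := Aform_eigvec xP; rewrite x1 mulr1 => <-.
by rewrite /Aform; under [leRHS]eq_bigr do under eq_bigr do rewrite sP.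
Qed.

Lemma graph_iso_lambda_min_le (a : R) n (G H : sgraph n) : (0 < n)%N ->
  graph_iso G H -> lambda_min a H <= lambda_min a G.
Proof.
move=> n0 [s sP]; have [x [x1 xP]] := lambda_min_eigvec a G n0.
have := lambda_min_le_Aform a H (fun i => x ((s^-1)%g i)) n0.
rewrite sqr_sum_reindex Aform_reindex x1 mulr1 => /le_trans; apply.
have := Aform_eigvec xP; rewrite x1 mulr1 => <-.
by rewrite /Aform; under eq_bigr do under eq_bigr do rewrite sP.
Qed.

(** The eigenvectors of [G], transported by [s], are test vectors for [H]. Each edge of [H] missing
    from [G] gains strictly more in the first form than [b] times the second, so [H] can fail to
    beat [G] only if no edge is missing. *)
Lemma embedding_iso (a b g : R) n (G H : sgraph n) (s : {perm 'I_n})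
    (x z : 'I_n -> R) :
    (0 < n)%N -> 0 <= b ->
    (forall i j, adj G i j -> adj H (s i) (s j)) ->
    \sum_i x i ^+ 2 = 1 -> is_eigvec a (lambda_max a G) G x ->
    \sum_i z i ^+ 2 = 1 -> is_eigvec g (lambda_min g G) G z ->
    (forall i j, adj H (s i) (s j) -> ~~ adj G i j ->
       b * (g * z i ^+ 2 + (1 - g) * (z i * z j)) <
       a * x i ^+ 2 + (1 - a) * (x i * x j)) ->
    lambda_max a H - b * lambda_min g H <= lambda_max a G - b * lambda_min g G ->
  graph_iso G H.
Proof.
move=> n0 b0 sub x1 xP z1 zP gap hF; exists s.
have h1 := Aform_le_lambda_max a H (fun i => x ((s^-1)%g i)) n0.
have h2 := lambda_min_le_Aform g H (fun i => z ((s^-1)%g i)) n0.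
rewrite sqr_sum_reindex Aform_reindex x1 mulr1 in h1.
rewrite sqr_sum_reindex Aform_reindex z1 mulr1 in h2.
have e1 := Aform_eigvec xP; rewrite x1 mulr1 in e1.
have e2 := Aform_eigvec zP; rewrite z1 mulr1 in e2.
set SX := \sum_i \sum_j _ in h1; set SZ := \sum_i \sum_j _ in h2.
(* [T i j] is the net gain from the ordered pair; it vanishes except at extra edges of [H], where it
   is positive. *)
pose T i j := ((adj H (s i) (s j))%:R - (adj G i j)%:R) *
  (a * x i ^+ 2 + (1 - a) * (x i * x j)
   - b * (g * z i ^+ 2 + (1 - g) * (z i * z j))).
have T0 i j : 0 <= T i j.
  rewrite /T; have [ij|nij] := boolP (adj G i j).
    by rewrite sub // subrr mul0r.
  have [hij|] := boolP (adj H (s i) (s j)); last by rewrite subrr mul0r.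
  by rewrite subr0 mul1r subr_ge0 ltW ?gap.
have sT : \sum_i \sum_j T i j <= 0.
  have -> : \sum_i \sum_j T i j = (SX - Aform a G x) - b * (SZ - Aform g G z).
    rewrite /Aform -!sumrB mulr_sumr -sumrB; apply: eq_bigr => i _.
    rewrite -!sumrB mulr_sumr -sumrB; apply: eq_bigr => j _; rewrite /T; ring.
  have := ler_wpM2l b0 h2; rewrite e1 e2; clearbody SX SZ; clear -h1 hF; lra.
move=> i j; have : T i j = 0.
  apply/eqP; rewrite eq_le T0 andbT; apply: le_trans sT.
  rewrite (bigD1 i) //= (bigD1 j) //= -addrA lerDl addr_ge0 ?sumr_ge0 // => u _.
  exact: sumr_ge0.
rewrite /T; have [ij _|nij] := boolP (adj G i j); first exact: sub.
have [hij|//] := boolP (adj H (s i) (s j)).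
by rewrite subr0 mul1r => /eqP; rewrite subr_eq0 gt_eqF ?gap.
Qed.

End Comparison.

(** * Extremal eigenvectors of competitors *)

Section Cases.
Context {R : realType}.

Lemma sqr_sum_split n (L : {set 'I_n}) (z : 'I_n -> R) :
  \sum_i z i ^+ 2 = \sum_(i in L) z i ^+ 2 + \sum_(i | i \notin L) z i ^+ 2.
Proof. exact: (bigID (fun i => i \in L)). Qed.

Lemma sqr_le_sum n (P : pred 'I_n) (z : 'I_n -> R) i :
  P i -> z i ^+ 2 <= \sum_(j | P j) z j ^+ 2.
Proof.
by move=> Pi; rewrite (bigD1 i) //= lerDl sumr_ge0 // => j _; apply: sqr_ge0.
Qed.

(* If nearly all the mass of [z] sits on the few vertices of [L], then along a
   path leading from [L] to its complement some edge has a large [z i + z j]. *)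
Lemma lambda_min_ge_low (g m l e : R) n (G : sgraph n) (L : {set 'I_n})
    (z : 'I_n -> R) h :
    2^-1 <= g < 1 -> graph_connected G ->
    \sum_i z i ^+ 2 = 1 -> is_eigvec g m G z -> 0 <= m ->
    1 <= l -> #|L|%:R <= l -> h \notin L -> 0 <= e -> 8 * l * e ^+ 2 <= 1 ->
    \sum_(i | i \notin L) z i ^+ 2 <= e ^+ 2 ->
  1 - g <= 16 * l ^+ 3 * m.
Proof.
case/andP=> g2 g1 cG z1 zP m0 l1 Ll hL e0 le2 zL.
(* The signless bound on one edge gives [(z i + z j) ^+ 2 <= r ^+ 2], so [|z|] changes by at most
   [r] along an edge. *)
pose r := Num.sqrt (2 * m / (1 - g)).
have g0 : 0 < 1 - g by rewrite subr_gt0.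
have r0 : 0 <= r by apply: sqrtr_ge0.
have r2 : (1 - g) * r ^+ 2 = 2 * m.
  rewrite sqr_sqrtr; last by rewrite divr_ge0 ?mulr_ge0 // ltW.
  by field; rewrite gt_eqF.
have zedge i j : adj G i j -> `|z i| <= `|z j| + r.
  move=> ij; have := lambda_min_ge_signless i j g2 (ltW g1) z1 zP.
  rewrite ij mul1r => h1.
  have h2 : (z i + z j) ^+ 2 <= r ^+ 2 by rewrite -(ler_pM2l g0); lra.
  have h3 : `|z i + z j| <= r.
    by rewrite -ler_sqr ?nnegrE // real_normK ?num_real.
  by have := ler_normB (z i + z j) (z j); rewrite addrK; lra.
have zout i : i \notin L -> `|z i| <= e.
  move=> iL; rewrite -ler_sqr ?nnegrE // real_normK ?num_real //.
  by apply: le_trans zL; apply: (@sqr_le_sum _ (fun i => i \notin L)).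
have zall i : z i ^+ 2 <= (e + l * r) ^+ 2.
  rewrite -[z i ^+ 2]real_normK ?num_real // lerXn2r ?nnegrE //.
    by rewrite addr_ge0 ?mulr_ge0 //; lra.
  apply: le_trans (connected_propagate cG r0 hL zout zedge i) _.
  by rewrite lerD2l ler_wpM2r.
have zin : \sum_(i in L) z i ^+ 2 <= l * (e + l * r) ^+ 2.
  apply: (@le_trans _ _ (\sum_(i in L) (e + l * r) ^+ 2)); first exact: ler_sum.
  by rewrite sumr_const -mulr_natl ler_wpM2r ?sqr_ge0.
have sq : (e + l * r) ^+ 2 <= 2 * e ^+ 2 + 2 * (l ^+ 2 * r ^+ 2).
  by have := sqr_ge0 (e - l * r); lra.
have l0 : 0 <= l by lra.
have lsq := ler_wpM2l l0 sq.
have e2l : e ^+ 2 <= l * e ^+ 2 by rewrite ler_peMl ?sqr_ge0.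
(* The unit mass is at most [3 * l * e ^+ 2 + 2 * l ^+ 3 * r ^+ 2], and the first term is at most
   3/8. *)
have : 1 <= 4 * (l ^+ 3 * r ^+ 2) by have := sqr_sum_split L z; lra.
move=> /(ler_wpM2l (ltW g0)).
have -> : (1 - g) * (4 * (l ^+ 3 * r ^+ 2)) = 8 * l ^+ 3 * m.
  have -> : 8 * l ^+ 3 * m = 4 * l ^+ 3 * (2 * m) by ring.
  by rewrite -r2; ring.
have : 0 <= l ^+ 3 * m by rewrite mulr_ge0 ?exprn_ge0.
by lra.
Qed.

(** In the eigenvalue equation at [v], Cauchy-Schwarz bounds the neighbour sum by [e] times the root
    of the degree, and [|z v| >= 1 / 2]. *)
Lemma lambda_min_ge_pendant (g m e : R) n (G : sgraph n) (z : 'I_n -> R) v :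
    0 <= g <= 1 -> \sum_i z i ^+ 2 = 1 -> is_eigvec g m G z ->
    (0 < degree G v)%N -> 0 <= e <= 1 / 2 ->
    \sum_(i | i \notin [set v]) z i ^+ 2 <= e ^+ 2 ->
  (degree G v)%:R * (g - 2 * e) <= m.
Proof.
case/andP=> g0 g1 z1 zP d1 /andP[e0 e2] zv; set k : R := (degree G v)%:R.
have k1 : 1 <= k by rewrite ler1n.
have zv2 : 1 / 4 <= z v ^+ 2.
  have := sqr_sum_split [set v] z; rewrite z1 big_set1.
  have : e ^+ 2 <= e * (1 / 2) by rewrite expr2 ler_wpM2l.
  by lra.
have h : (g * k - m) ^+ 2 * z v ^+ 2 <= k * e ^+ 2.
  rewrite -exprMn.
  have -> : (g * k - m) * z v = - ((1 - g) * \sum_j (adj G v j)%:R * z j).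
    by rewrite mulrBl zP -/k; ring.
  rewrite sqrrN exprMn -[leRHS]mul1r; apply: ler_pM; rewrite ?sqr_ge0 //.
    by rewrite -[leRHS](expr1n _ 2) lerXn2r ?nnegrE //; lra.
  apply: le_trans (nbsum_sqr_le _ _ _) _; apply: ler_wpM2l; first by lra.
  apply: le_trans zv; rewrite big_mkcond [leRHS]big_mkcond; apply: ler_sum => j _.
  rewrite inE; case: (eqVneq j v) => [->|_]; first by rewrite adj_irr.
  by case: ifP => // _; apply: sqr_ge0.
have h' : (g * k - m) ^+ 2 * (1 / 4) <= k * e ^+ 2.
  by apply: le_trans h; rewrite ler_wpM2l ?sqr_ge0.
have h2 : (g * k - m) ^+ 2 <= (2 * (k * e)) ^+ 2.
  rewrite !exprMn.
  have : k * e ^+ 2 <= k ^+ 2 * e ^+ 2 by rewrite ler_wpM2r ?sqr_ge0 // expr2 ler_peMl //; lra.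
  by lra.
have ke : 0 <= 2 * (k * e) by rewrite !mulr_ge0 //; lra.
have : `|g * k - m| <= 2 * (k * e).
  by rewrite -ler_sqr ?nnegrE // real_normK ?num_real.
rewrite ler_norml => /andP[_]; lra.
Qed.

(** The entry sum [S] nearly attains its maximum [t], so [x] is close in norm to a constant vector.
    A vertex of degree at least [eta * t ^+ 2] thus has neighbour sum of order [t], and the
    eigenvalue equation divides this by at most [t ^+ 2]. *)
Lemma lambda_max_entry_ge (a C t eta : R) n (G : sgraph n) (x : 'I_n -> R) :
    0 <= a < 1 -> n%:R = t ^+ 2 -> 1 <= C -> nonedges G <= C * n%:R ->
    t ^+ 2 - 3 <= lambda_max a G -> 4 * (1 + 2 / (1 - a)) <= t ^+ 2 ->
    0 < eta <= 1 -> 1 <= t -> 16 * (3 / (1 - a) + C) <= eta ^+ 2 * t ->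
    \sum_i x i ^+ 2 = 1 -> is_eigvec a (lambda_max a G) G x ->
    0 <= \sum_i x i ->
  forall i, i \notin low_vertices eta G -> (1 - a) * eta / 4 <= t * x i.
Proof.
move=> /andP[a0 a1] nt C1 hne hl tl /andP[eta0 eta1] t1 tlarge x1 xP s0 i iL.
have b0 : 0 < 1 - a by rewrite subr_gt0.
pose b := (1 - a)^-1; have bE : (1 - a) * b = 1 by rewrite mulfV // gt_eqF.
rewrite -/b in tlarge tl; have bp : 0 < b by rewrite invr_gt0.
have t0 : 0 <= t by lra.
set S := \sum_i x i in s0 *; pose E := 3 * b + C.
have Ep : 0 < E by rewrite /E; lra.
have Ss : t ^+ 2 - E * t <= S ^+ 2.
  have := Aform_eigvec xP; rewrite x1 mulr1 Aform_split.
  rewrite nt in hne; have := adj_form_bounds x C1 t0 hne; rewrite x1 mulr1 -/S.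
  set A := \sum_i \sum_j _ => /andP[_ A2].
  set D := (X in a * X) => eA.
  have Dle : D <= t ^+ 2 - 1.
    rewrite -nt -[leRHS]mulr1 -[X in _ * X]x1 mulr_sumr; apply: ler_sum => j _.
    by apply: ler_wpM2r; rewrite ?sqr_ge0 ?degree_le.
  have aD := ler_wpM2l a0 Dle; have bA := ler_wpM2l (ltW b0) A2.
  rewrite -(ler_pM2l b0) /E.
  have : (1 - a) * ((3 * b + C) * t) = 3 * t + (1 - a) * (C * t).
    have -> : (1 - a) * ((3 * b + C) * t) = 3 * ((1 - a) * b) * t + (1 - a) * (C * t).
      by ring.
    by rewrite bE mulr1.
  by lra.
have Et : 16 * E <= t.
  apply: le_trans tlarge _; rewrite ler_piMl // expr_le1 //; lra.
have Sge : t / 2 <= S.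
  rewrite -ler_sqr ?nnegrE //; last by lra.
  have : E * t <= t / 16 * t by rewrite ler_wpM2r //; lra.
  by lra.
have Ett : E * t <= (eta * t / 4) ^+ 2.
  have := ler_wpM2r t0 tlarge; rewrite -/E; lra.
have dge : eta * t ^+ 2 <= (degree G i)%:R by move: iL; rewrite inE -leNgt nt.
have dle : (degree G i)%:R <= t ^+ 2 - 1 by rewrite -nt degree_le.
have tp : 0 < t ^+ 2 by rewrite exprn_gt0 //; lra.
(* [u] is the mean of [x]; the deviation [y] has squared norm [1 - S * u], at most [E / t]. *)
pose u := S / t ^+ 2; have uE : t ^+ 2 * u = S by rewrite mulrC divfK // gt_eqF.
pose y j := x j - u.
have sy : \sum_j y j ^+ 2 = 1 - S * u.
  have -> : \sum_j y j ^+ 2 = \sum_j (x j ^+ 2 - 2 * u * x j + u ^+ 2).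
    by apply: eq_bigr => j _; rewrite /y; ring.
  rewrite big_split sumrB /= x1 -mulr_sumr -/S sumr_const card_ord.
  rewrite -[u ^+ 2 *+ n]mulr_natl nt.
  by rewrite -uE; ring.
have nby : `|\sum_j (adj G i j)%:R * y j| <= eta * t / 4.
  have q0 : 0 <= eta * t / 4 by rewrite divr_ge0 ?mulr_ge0 // ltW.
  rewrite -ler_sqr ?nnegrE // real_normK ?num_real //.
  apply: le_trans Ett; apply: le_trans (nbsum_sqr_le _ _ _) _.
  apply: (@le_trans _ _ (t ^+ 2 * (1 - S * u))).
    apply: ler_pM => //; first by apply: sumr_ge0 => j _; apply: sqr_ge0.
      by lra.
    rewrite -sy big_mkcond; apply: ler_sum => j _.
    by case: ifP => // _; apply: sqr_ge0.
  rewrite mulrBr mulr1 [S * u]mulrC mulrA uE; lra.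
have nbx : eta * t / 4 <= \sum_j (adj G i j)%:R * x j.
  have -> : \sum_j (adj G i j)%:R * x j =
      (degree G i)%:R * u + \sum_j (adj G i j)%:R * y j.
    rewrite degreeE mulr_suml -big_split; apply: eq_bigr => j _ /=.
    by rewrite /y; ring.
  have u0 : 0 <= u by rewrite divr_ge0 // ltW.
  have h1 : eta * S <= (degree G i)%:R * u by rewrite -uE mulrA ler_wpM2r.
  have := ler_wpM2l (ltW eta0) Sge => h2.
  by move: nby; rewrite ler_norml => /andP[]; lra.
have lam_le : lambda_max a G <= t ^+ 2 - 1.
  by rewrite -nt; apply: lambda_max_le; [exact: ltW | rewrite -(ltr_nat R) nt].
have ad := ler_wpM2l a0 dle; have ad0 : 0 <= a * (degree G i)%:R by rewrite mulr_ge0.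
have eq : (lambda_max a G - a * (degree G i)%:R) * x i
    = (1 - a) * \sum_j (adj G i j)%:R * x j by rewrite mulrBl xP; ring.
have lo := ler_wpM2l (ltW b0) nbx; rewrite -eq in lo.
have cpos : 0 < lambda_max a G - a * (degree G i)%:R.
  have : (1 - a) * 8 * b <= (1 - a) * t ^+ 2.
    by rewrite -mulrA ler_pM2l //; lra.
  have : (1 - a) * 4 <= (1 - a) * t ^+ 2 by rewrite ler_pM2l //; lra.
  by lra.
have eta_t : 0 < (1 - a) * (eta * t / 4).
  by rewrite mulr_gt0 // divr_gt0 // mulr_gt0 //; lra.
have xi : 0 < x i by rewrite -(pmulr_rgt0 _ cpos); lra.
have up : (lambda_max a G - a * (degree G i)%:R) * x i <= t ^+ 2 * x i.
  by rewrite ler_wpM2r ?ltW //; lra.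
have tp' : 0 < t by lra.
by rewrite -(ler_pM2l tp'); lra.
Qed.

(** In the eigenvalue equation at [i] the coefficient is at least [eta * t ^+ 2 / 4], while the
    squared neighbour sum is only of order [t]: [v] contributes at most 1, and the remaining mass
    [D / t] is spread over at most [t ^+ 2] neighbours. *)
Lemma lambda_min_entry_le (g m t eta D : R) n (G : sgraph n) (z : 'I_n -> R) v :
    2^-1 <= g <= 1 -> n%:R = t ^+ 2 -> 0 < eta -> 1 <= t -> 4 * m <= eta * t ^+ 2 ->
    \sum_i z i ^+ 2 = 1 -> is_eigvec g m G z -> 0 <= D ->
    \sum_(i | i \notin [set v]) z i ^+ 2 <= D / t ->
  forall i, i \notin low_vertices eta G -> eta ^+ 2 * t ^+ 3 * z i ^+ 2 <= 32 * (1 + D).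
Proof.
move=> /andP[g2 g1] nt eta0 t1 ml z1 zP D0 zv i iL.
have t0 : 0 < t by lra.
have dge : eta * t ^+ 2 <= (degree G i)%:R by move: iL; rewrite inE -leNgt nt.
set S := \sum_j (adj G i j)%:R * z j.
have eq : (g * (degree G i)%:R - m) * z i = - ((1 - g) * S).
  by rewrite mulrBl zP -/S; ring.
have S2 : S ^+ 2 <= 2 * (1 + D) * t.
  pose z' j := (j != v)%:R * z j.
  have SE : S = (adj G i v)%:R * z v + \sum_j (adj G i j)%:R * z' j.
    rewrite /S (bigD1 v) //=; congr (_ + _); rewrite [RHS](bigD1 v) //=.
    rewrite /z' eqxx mul0r mulr0 add0r; apply: eq_bigr => j jv.
    by rewrite jv mul1r.
  have q1 : ((adj G i v)%:R * z v) ^+ 2 <= 1.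
    have zv1 : z v ^+ 2 <= 1 by rewrite -z1; apply: (@sqr_le_sum _ predT).
    by rewrite exprMn; case: adj; rewrite ?expr1n ?mul1r // expr0n mul0r.
  have q2 : (\sum_j (adj G i j)%:R * z' j) ^+ 2 <= D * t.
    apply: le_trans (nbsum_sqr_le _ _ _) _.
    have -> : D * t = t ^+ 2 * (D / t) by field; rewrite gt_eqF.
    apply: ler_pM => //; first by apply: sumr_ge0 => j _; apply: sqr_ge0.
      by rewrite -nt; have := degree_le (R := R) G i; lra.
    apply: le_trans zv; rewrite big_mkcond [leRHS]big_mkcond; apply: ler_sum => j _.
    rewrite inE /z'; case: (eqVneq j v) => [->|_]; first by rewrite mul0r expr0n; case: ifP.
    by rewrite mul1r; case: ifP => // _; apply: sqr_ge0.
  rewrite SE; set A := _ * z v in q1 *; set B := \sum_j _ in q2 *.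
  by have := sqr_ge0 (A - B); lra.
have c1 : eta * t ^+ 2 / 4 <= g * (degree G i)%:R - m.
  have dd : 0 <= (g - 2^-1) * (degree G i)%:R by rewrite mulr_ge0 ?subr_ge0.
  by lra.
have c0 : 0 <= eta * t ^+ 2 / 4 by rewrite divr_ge0 ?mulr_ge0 ?sqr_ge0 // ltW.
have c2 : (eta * t ^+ 2 / 4) ^+ 2 * z i ^+ 2 <= 2 * (1 + D) * t.
  apply: le_trans S2.
  apply: (@le_trans _ _ ((g * (degree G i)%:R - m) ^+ 2 * z i ^+ 2)).
    by rewrite ler_wpM2r ?sqr_ge0 // lerXn2r ?nnegrE // (le_trans c0).
  rewrite -exprMn eq sqrrN exprMn ler_piMl ?sqr_ge0 // expr_le1 //; lra.
by rewrite -(ler_pM2l t0); lra.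
Qed.

End Cases.

(** * Case analysis on the low vertices of a competitor *)

Lemma eventually_all_le (R : realType) (s : seq R) :
  exists K : R, forall t, K <= t -> all (fun c => c <= t) s.
Proof.
elim: s => [|c s [K KP]]; first by exists 0.
by exists (Num.max c K) => t; rewrite ge_max => /andP[ct /KP]; rewrite /= ct.
Qed.

Lemma connected_degree_gt0 n (G : sgraph n) v u :
  graph_connected G -> u != v -> (0 < degree G v)%N.
Proof.
move=> cG uv.
have [|//|a [w [/set1P-> _ vw]]] := @connected_crossing n G [set v] v u cG.
- exact: set11.
- by rewrite inE.
by rewrite card_gt0; apply/set0Pn; exists w; rewrite inE.
Qed.

Lemma kite_value_ge (R : realType) (a b g : R) m : 0 <= a <= 1 -> 0 <= b ->
  m%:R - b * g <= lambda_max a (kite m.+2) - b * lambda_min g (kite m.+2).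
Proof.
by move=> a01 b0; apply: lerB; rewrite ?lambda_max_kite // ler_wpM2l ?lambda_min_kite.
Qed.

Lemma lambda_min_high_mass (R : realType) (g m C C2 t eta : R) n (G : sgraph n)
    (z : 'I_n -> R) :
    2^-1 <= g <= 1 -> 1 <= C -> 1 <= t -> n%:R = t ^+ 2 ->
    nonedges G <= C * n%:R -> 0 <= m -> m + 1 + C <= C2 -> 0 < eta ->
    \sum_i z i ^+ 2 = 1 -> is_eigvec g m G z ->
  \sum_(i | i \notin low_vertices eta G) z i ^+ 2 <= 2 * C2 / eta / t.
Proof.
case/andP=> g2 g1 C1 t1 nt hne m0 mC eta0 z1 zP.
have t0 : 0 < t by lra.
have n0 : (0 < n)%N by rewrite -(ltr_nat R) nt exprn_gt0.
have hg : 0 <= g <= 1 by apply/andP; split; lra.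
rewrite nt in hne.
have := lambda_min_degree_mass hg C1 (ltW t0) hne z1 zP.
set D := \sum_i _ => hD.
have D0 : 0 <= D by apply: sumr_ge0 => i _; rewrite mulr_ge0 ?sqr_ge0.
have hD' : D <= 2 * C2 * t.
  (* Since [g >= 1 / 2], dividing by [g] costs at most the factor 2. *)
  have h1 : 0 <= (g - 2^-1) * D by rewrite mulr_ge0 ?subr_ge0.
  have h2 : m + 1 <= (m + 1) * t by rewrite ler_peMr //; lra.
  have h3 := ler_wpM2r (ltW t0) mC.
  by clear -h1 h2 h3 hD; lra.
have := high_vertices_mass eta0 n0 hD'; rewrite nt.
have -> // : 2 * C2 * t / (eta * t ^+ 2) = 2 * C2 / eta / t.
by field; rewrite !gt_eqF.
Qed.

(** Two low vertices bring [lambda_max] down to [n - 3 + 8 * eta], and [b] times the lower bound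
    [(1 - g) / (16 * l ^+ 3)] on [lambda_min] exceeds [8 * eta]. *)
Lemma two_low_vertices_value (R : realType) (a b g l e eta : R) n (G : sgraph n)
    (z : 'I_n -> R) v w :
    0 <= a < 1 -> 4 * (1 + 2 / (1 - a)) <= n%:R -> n%:R - 3 <= lambda_max a G ->
    2^-1 <= g < 1 -> 0 < b -> graph_connected G -> 0 <= lambda_min g G ->
    \sum_i z i ^+ 2 = 1 -> is_eigvec g (lambda_min g G) G z ->
    1 <= l -> 0 <= e -> 8 * l * e ^+ 2 <= 1 -> l < n%:R -> 3 <= n%:R :> R ->
    #|low_vertices eta G|%:R <= l ->
    \sum_(i | i \notin low_vertices eta G) z i ^+ 2 <= e ^+ 2 ->
    v \in low_vertices eta G -> w \in low_vertices eta G -> w != v ->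
    8 * eta * (16 * l ^+ 3) < b * (1 - g) ->
  lambda_max a G - b * lambda_min g G < n%:R - 3.
Proof.
move=> ha nlarge lam3 hg b0 cG mu0 z1 zP l1 e0 le ln n3 Lcard zmass vL wL wv bound.
have [h hL] : exists h, h \notin low_vertices eta G.
  apply/existsP; rewrite -negb_forall; apply/negP => /forallP Lall.
  have LT : low_vertices eta G = setT by apply/setP=> i; rewrite Lall inE.
  by move: Lcard; rewrite LT cardsT card_ord leNgt ln.
have muge := lambda_min_ge_low hg cG z1 zP mu0 l1 Lcard hL e0 le zmass.
have vw2 : #|[set v; w]| = 2%N by rewrite cards2 eq_sym wv.
have := @lambda_max_le_low _ a _ G [set v; w] ha nlarge lam3.
rewrite vw2 (big_setD1 v) ?set21 //=.
have -> : [set v; w] :\ v = [set w].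
  apply/setP=> i; rewrite !inE; case: (eqVneq i v) => //= ->.
  by rewrite eq_sym (negbTE wv).
have n2 : 2 <= n%:R - 1 :> R by clear -n3; lra.
rewrite big_set1 => /(_ n2) hlam.
move: vL wL; rewrite !inE => dv dw.
have n0 : 0 < n%:R :> R by clear -n3; lra.
have h8 : 4 / n%:R * ((degree G v)%:R + (degree G w)%:R) <= 8 * eta.
  have -> : 8 * eta = 4 / n%:R * (2 * eta * n%:R) by field; rewrite gt_eqF.
  by rewrite ler_pM2l ?divr_gt0 //; clear -dv dw; lra.
have bmu : 8 * eta < b * lambda_min g G.
  have l3 : 0 < 16 * l ^+ 3 by rewrite mulr_gt0 ?exprn_gt0 //; clear -l1; lra.
  rewrite -(ltr_pM2r l3); apply: lt_le_trans bound _.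
  by rewrite -mulrA ler_pM2l // [_ * (16 * _)]mulrC.
by clear -h8 bmu hlam; lra.
Qed.

(** With [k] the degree of [v], the gain [4 * k / n] is at most a quarter of [b * g * k] and the
    error [2 * b * e * k] at most a sixteenth. For [k >= 2] the net loss is at least
    [11 / 8 * b * g]. *)
Lemma one_low_vertex_value (R : realType) (a b g e : R) n (G : sgraph n)
    (z : 'I_n -> R) v :
    0 <= a < 1 -> 4 * (1 + 2 / (1 - a)) <= n%:R -> n%:R - 3 <= lambda_max a G ->
    2^-1 <= g <= 1 -> 0 < b -> 2 <= n%:R :> R -> 16 <= b * g * n%:R ->
    \sum_i z i ^+ 2 = 1 -> is_eigvec g (lambda_min g G) G z ->
    0 <= e <= 1 / 64 -> \sum_(i | i \notin [set v]) z i ^+ 2 <= e ^+ 2 ->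
    (1 < degree G v)%N ->
  lambda_max a G - b * lambda_min g G < n%:R - 2 - b * g.
Proof.
move=> ha nlarge lam3 /andP[g2 g1] b0 n2 n16 z1 zP /andP[e0 e64] zmass dv2.
set k : R := (degree G v)%:R; have k2 : 2 <= k by rewrite (ler_nat _ 2).
have := @lambda_max_le_low _ a _ G [set v] ha nlarge lam3.
have n1 : 1 <= n%:R - 1 :> R by clear -n2; lra.
rewrite cards1 big_set1 -/k => /(_ n1) hlam.
have muge : k * (g - 2 * e) <= lambda_min g G.
  have hg : 0 <= g <= 1 by rewrite g1 andbT; clear -g2; lra.
  have he : 0 <= e <= 1 / 2 by rewrite e0 /=; clear -e64; lra.
  exact: lambda_min_ge_pendant hg z1 zP (ltnW dv2) he zmass.
have n0 : 0 < n%:R :> R by clear -n2; lra.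
have k0 : 0 <= k by clear -k2; lra.
have bg0 : 0 < b * g by rewrite mulr_gt0 //; clear -g2; lra.
have kn : 4 / n%:R * k <= b * g / 4 * k.
  by rewrite ler_wpM2r // ler_pdivrMr //; clear -n16; lra.
have bmu := ler_wpM2l (ltW b0) muge.
have be : b * e * k <= b * g / 32 * k.
  by rewrite ler_wpM2r // -mulrA ler_pM2l //; clear -g2 e64; lra.
have kk : b * g * 2 <= b * g * k by rewrite ler_pM2l.
by clear -hlam kn bmu be kk bg0; lra.
Qed.

(* Adding a missing edge of the kite raises [lambda_max] by order [1 / t ^+ 2]
   at least, but [lambda_min] only by [O(1 / t ^+ 3)]. *)
Lemma pendant_iso_kite (R : realType) (a b g C t eta D : R) m (G : sgraph m.+2)
    (z : 'I_m.+2 -> R) v :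
    0 <= a < 1 -> 2^-1 <= g <= 1 -> 0 < b -> m.+2%:R = t ^+ 2 -> 1 <= t ->
    1 <= C -> nonedges G <= C * m.+2%:R ->
    m.+2%:R - 3 <= lambda_max a G -> 4 * (1 + 2 / (1 - a)) <= t ^+ 2 ->
    0 < eta <= 1 -> 16 * (3 / (1 - a) + C) <= eta ^+ 2 * t ->
    4 * lambda_min g G <= eta * t ^+ 2 ->
    \sum_i z i ^+ 2 = 1 -> is_eigvec g (lambda_min g G) G z -> 0 <= D ->
    \sum_(i | i \notin [set v]) z i ^+ 2 <= D / t ->
    b * (32 * (1 + D)) < ((1 - a) * eta / 4) ^+ 2 * eta ^+ 2 * t ->
    low_vertices eta G = [set v] -> degree G v = 1%N ->
    lambda_max a (kite m.+2) - b * lambda_min g (kite m.+2)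
      <= lambda_max a G - b * lambda_min g G ->
  graph_iso G (kite m.+2).
Proof.
move=> ha hg b0 nt t1 C1 hne lam3 tlarge heta etat mut z1 zP D0 zmass gap Lv dv1 hF.
have /andP[a0 a1] := ha; have /andP[g2 g1] := hg; have /andP[eta0 _] := heta.
have t0 : 0 < t by clear -t1; lra.
have a'0 : 0 <= 1 - a by clear -a1; lra.
have g'0 : 0 <= 1 - g by clear -g1; lra.
have g0 : 0 <= g by clear -g2; lra.
have [w vE] : exists w, [set j | adj G v j] = [set w] by apply/cards1P/eqP.
have vw : adj G v w by have := set11 w; rewrite -vE inE.
have vP u : adj G v u -> u = w by move=> vu; apply/set1P; rewrite -vE inE.
have [s s1 s2] := pendant_embeds_kite vw vP.
(* The eigenvector is fixed only up to sign; the lower bound on its entries needs a nonnegative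
   sum. *)
have [x [x1 xP x_ge0]] : exists x : 'I_m.+2 -> R,
    [/\ \sum_i x i ^+ 2 = 1, is_eigvec a (lambda_max a G) G x & 0 <= \sum_i x i].
  have [x0 [x01 x0P]] := lambda_max_eigvec a G (ltn0Sn _).
  have [sx|sx] := leP 0 (\sum_i x0 i); first by exists x0.
  exists (fun i => - x0 i); split.
  - by rewrite -x01; apply: eq_bigr => i _; rewrite sqrrN.
  - move=> i; rewrite mulrN x0P; under [in RHS]eq_bigr do rewrite mulrN.
    by rewrite sumrN; ring.
  - by rewrite sumrN oppr_ge0 ltW.
set kap := (1 - a) * eta / 4 in gap.
have lam3' := lam3; rewrite nt in lam3'.
have high i : i != v -> i \notin low_vertices eta G by rewrite Lv inE.
have xge i : i != v -> kap / t <= x i.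
  move=> /high iv; rewrite ler_pdivrMr // [_ * t]mulrC.
  exact: (lambda_max_entry_ge ha nt C1 hne lam3' tlarge heta t1 etat x1 xP x_ge0 iv).
pose P := 32 * (1 + D) / (eta ^+ 2 * t ^+ 3).
have et0 : 0 < eta ^+ 2 * t ^+ 3 by rewrite mulr_gt0 ?exprn_gt0.
have zle i : i != v -> z i ^+ 2 <= P.
  move=> /high iv; rewrite ler_pdivlMr // [_ * (_ * _)]mulrC.
  exact: (lambda_min_entry_le hg nt eta0 t1 mut z1 zP D0 zmass iv).
apply: (embedding_iso (ltn0Sn _) (ltW b0) s1 x1 xP z1 zP _ hF) => i j kij nij.
have [iv jv] := s2 _ _ kij nij.
have zz : g * z i ^+ 2 + (1 - g) * (z i * z j) <= P.
  have h1 : z i * z j <= P.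
    by have := sqr_ge0 (z i - z j); have := zle _ iv; have := zle _ jv; clear; lra.
  have h2 := ler_wpM2l g0 (zle _ iv); have h3 := ler_wpM2l g'0 h1.
  by clear -h2 h3; lra.
have kt0 : 0 <= kap / t by rewrite !mulr_ge0 ?invr_ge0 // ltW.
have xx : (kap / t) ^+ 2 <= a * x i ^+ 2 + (1 - a) * (x i * x j).
  have h1 : (kap / t) ^+ 2 <= x i * x j by rewrite expr2 ler_pM ?xge.
  have h0 : (kap / t) ^+ 2 <= x i ^+ 2 by rewrite [leRHS]expr2 expr2 ler_pM ?xge.
  have h2 := ler_wpM2l a0 h0; have h3 := ler_wpM2l a'0 h1.
  by clear -h2 h3; lra.
apply: lt_le_trans xx; apply: (@le_lt_trans _ _ (b * P)); first by rewrite ler_pM2l.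
(* Both sides are brought over the denominator of [P], which reduces the comparison to [gap]. *)
have -> : (kap / t) ^+ 2 = kap ^+ 2 * eta ^+ 2 * t / (eta ^+ 2 * t ^+ 3).
  by clearbody kap; field; rewrite !gt_eqF.
by rewrite /P mulrA ltr_pM2r ?invr_gt0.
Qed.

(** The constants are chosen in the order [C], [l], [e], [eta], [K]. In particular [l], which bounds
    the number of low vertices, is fixed before [eta], so [eta] may be taken small in terms of
    [l]. *)
Lemma kite_unique_large (R : realType) (alpha beta gamma : R) :
    0 <= alpha < 1 -> 1 / 2 <= gamma < 1 -> 0 < beta -> beta * gamma <= 1 ->
  exists K : R, forall m (G : sgraph m.+2), K <= Num.sqrt m.+2%:R ->
    graph_connected G ->
    lambda_max alpha (kite m.+2) - beta * lambda_min gamma (kite m.+2)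
      <= lambda_max alpha G - beta * lambda_min gamma G ->
    graph_iso G (kite m.+2).
Proof.
move=> ha /andP[g2 g1] b0 bg; have /andP[a0 a1] := ha.
have g2' : 2^-1 <= gamma by lra.
have hg : 2^-1 <= gamma < 1 by rewrite g2'.
have hg' : 2^-1 <= gamma <= 1 by rewrite g2' ltW.
have a01 : 0 <= alpha <= 1 by rewrite a0 ltW.
have a'0 : 0 < 1 - alpha by rewrite subr_gt0.
have ia0 : 0 < (1 - alpha)^-1 by rewrite invr_gt0.
have bg0 : 0 < beta * gamma by rewrite mulr_gt0 //; lra.
set C := 1 + 4 / (1 - alpha).
have C1 : 1 <= C by rewrite /C; lra.
have [l [l4 lC]] : exists l : R, 4 <= l /\ 4 * C = l by exists (4 * C); split; lra.
have l0 : 0 < l by lra.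
have l1 : 1 <= l by lra.
have [e [e0 el]] : exists e : R, 0 < e /\ e * l = 1 / 16.
  exists (16 * l)^-1; rewrite invr_gt0 mulr_gt0 //; split => //.
  by field; rewrite gt_eqF.
have e64 : e <= 1 / 64 by rewrite -(ler_pM2r l0) el; lra.
have le : 8 * l * e ^+ 2 <= 1.
  by rewrite -mulrA expr2 [l * _]mulrC -mulrA el; lra.
have l3 : 0 < 16 * l ^+ 3 by rewrite mulr_gt0 ?exprn_gt0.
have [eta [eta0 eta2 etab]] : exists eta : R,
    [/\ 0 < eta, eta <= 1 / 2 & 8 * eta * (16 * l ^+ 3) < beta * (1 - gamma)].
  (* At [eta = q] the left side of the last condition is half of the right side. *)
  pose q := beta * (1 - gamma) / (16 * (16 * l ^+ 3)).
  have q0 : 0 < q by rewrite divr_gt0 ?mulr_gt0 ?subr_gt0 ?exprn_gt0.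
  exists (Num.min (1 / 2) q); rewrite lt_min ge_min lexx q0 andbT divr_gt0 //.
  split=> //; apply: (@le_lt_trans _ _ (8 * q * (16 * l ^+ 3))).
    by rewrite ler_pM2r // ler_pM2l // ge_min lexx orbT.
  have -> : 8 * q * (16 * l ^+ 3) = beta * (1 - gamma) / 2.
    by rewrite /q; field; rewrite gt_eqF.
  by rewrite ltr_pdivrMr // ltr_pMr ?ltr1n // mulr_gt0 ?subr_gt0.
set C2 := 2 / beta + 1 + C.
have ib0 : 0 < beta^-1 by rewrite invr_gt0.
have C20 : 0 < C2 by rewrite /C2; lra.
set D := 2 * C2 / eta.
have D0 : 0 < D by rewrite divr_gt0 ?mulr_gt0.
set kap := (1 - alpha) * eta / 4.
have kap0 : 0 < kap by rewrite divr_gt0 ?mulr_gt0.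
(* Each entry supplies one largeness condition on [t], or on [n] through [t <= t ^+ 2]; the two
   summands 1 make [l < n] and [gap] strict. *)
have [K KP] := eventually_all_le [:: 1; 4 * (1 + 2 / (1 - alpha)); D / e ^+ 2;
  l + 1; 16 / (beta * gamma); 16 * (3 / (1 - alpha) + C) / eta ^+ 2;
  8 / beta / eta; beta * (32 * (1 + D)) / (kap ^+ 2 * eta ^+ 2) + 1].
exists K => m G; set t := Num.sqrt m.+2%:R => /KP /=.
case/and5P=> t1 ta te tl /and5P[tbg teta tmu tgap _] cG hF.
have t0 : 0 < t by apply: lt_le_trans t1.
have nt : m.+2%:R = t ^+ 2 :> R by rewrite sqr_sqrtr.
have tt : t <= t ^+ 2 by rewrite expr2 ler_peMl // ltW.
have nlarge : 4 * (1 + 2 / (1 - alpha)) <= m.+2%:R.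
  by rewrite nt; apply: le_trans tt.
have n4 : 4 <= m.+2%:R :> R.
  by rewrite nt; apply: le_trans tt; clear -tl l4; lra.
have [z [z1 zP]] := lambda_min_eigvec gamma G (ltn0Sn _).
have mu0 : 0 <= lambda_min gamma G.
  (* The pair of equal vertices is not an edge, so the signless bound reads
     [0 <= lambda_min gamma G]. *)
  have := lambda_min_ge_signless ord0 ord0 g2' (ltW g1) z1 zP.
  by rewrite adj_irr mul0r mulr0.
have hF' : m.+2%:R - 2 - beta * gamma <= lambda_max alpha G - beta * lambda_min gamma G.
  apply: le_trans hF; have := kite_value_ge gamma m a01 (ltW b0).
  by rewrite -[m.+2%:R]natr1 -[m.+1%:R]natr1; clear; lra.
have bmu0 : 0 <= beta * lambda_min gamma G by rewrite mulr_ge0 // ltW.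
have lam3 : m.+2%:R - 3 <= lambda_max alpha G by clear -hF' bmu0 bg; lra.
have lam1 := lambda_max_le G (ltW a1) (ltn0Sn _).
(* Since [lambda_max <= n - 1] and the value is at least [n - 3], at most 2 is left for
   [beta * lambda_min]. *)
have mu2 : lambda_min gamma G <= 2 / beta.
  by rewrite ler_pdivlMr //; clear -hF' lam1 bg; lra.
have hne : nonedges G <= C * m.+2%:R.
  by apply: nonedges_le => //; clear -nlarge ia0; lra.
have Lcard : #|low_vertices eta G|%:R <= l by rewrite -lC; apply: low_vertices_card.
have muC : lambda_min gamma G + 1 + C <= C2 by rewrite /C2 !lerD2r.
have zmass := lambda_min_high_mass hg' C1 t1 nt hne mu0 muC eta0 z1 zP.
rewrite -/D in zmass.
have zmass_e : \sum_(i | i \notin low_vertices eta G) z i ^+ 2 <= e ^+ 2.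
  apply: le_trans zmass _; rewrite ler_pdivrMr // mulrC -ler_pdivrMr //.
  exact: exprn_gt0.
have [L0|[v vL]] := set_0Vmem (low_vertices eta G).
  (* Without low vertices the whole unit mass would be at most [e ^+ 2 < 1]. *)
  have := sqr_sum_split (low_vertices eta G) z; rewrite z1 {1}L0 big_set0 add0r => z1'.
  have e1 : e < 1 by apply: le_lt_trans e64 _; clear; lra.
  by move: zmass_e; rewrite -z1' leNgt expr_lt1 ?ltW // e1.
have [Lv|[w]] := set_0Vmem (low_vertices eta G :\ v); last first.
  rewrite in_setD1 => /andP[wv wL].
  have ln : l < m.+2%:R by rewrite nt; apply: lt_le_trans tt; clear -tl; lra.
  have n3 : 3 <= m.+2%:R :> R by clear -n4; lra.
  have := two_low_vertices_value ha nlarge lam3 hg b0 cG mu0 z1 zP l1 (ltW e0) le ln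
    n3 Lcard zmass_e vL wL wv etab.
  by clear -hF' bg; lra.
have {}Lv : low_vertices eta G = [set v] by rewrite -(setD1K vL) Lv setU0.
rewrite Lv in zmass zmass_e.
have dv0 : (0 < degree G v)%N.
  apply: (@connected_degree_gt0 _ G v (if v == ord0 then ord_max else ord0)) => //.
  by case: (eqVneq v ord0) => [->|]; rewrite // eq_sym.
have dv1 : degree G v = 1%N.
  apply/eqP; rewrite eqn_leq dv0 andbT leqNgt; apply/negP => dv2.
  have n16 : 16 <= beta * gamma * m.+2%:R.
    by rewrite mulrC -ler_pdivrMr // nt; apply: le_trans tt.
  have he : 0 <= e <= 1 / 64 by rewrite e64 ltW.
  have n2 : 2 <= m.+2%:R :> R by clear -n4; lra.
  have := one_low_vertex_value ha nlarge lam3 hg' b0 n2 n16 z1 zP he zmass_e dv2.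
  by rewrite ltNge hF'.
have etat : 16 * (3 / (1 - alpha) + C) <= eta ^+ 2 * t.
  by rewrite [_ ^+ 2 * t]mulrC -ler_pdivrMr // exprn_gt0.
have mut : 4 * lambda_min gamma G <= eta * t ^+ 2.
  apply: (@le_trans _ _ (eta * t)); last by rewrite ler_pM2l.
  by move: tmu; rewrite ler_pdivrMr // [t * _]mulrC; clear -mu2; lra.
have heta : 0 < eta <= 1 by rewrite eta0 (le_trans eta2) //; clear; lra.
have gap : beta * (32 * (1 + D)) < kap ^+ 2 * eta ^+ 2 * t.
  have ke0 : 0 < kap ^+ 2 * eta ^+ 2 by rewrite mulr_gt0 ?exprn_gt0.
  rewrite [_ * _ * t]mulrC -ltr_pdivrMr //.
  by apply: lt_le_trans tgap; rewrite ltrDl.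
rewrite nt in nlarge.
exact: (pendant_iso_kite ha hg' b0 nt t1 C1 hne lam3 nlarge heta etat mut z1 zP
  (ltW D0) zmass gap Lv dv1 hF).
Qed.

Unset Implicit Arguments.

Theorem theorem1p2 (R : realType) (alpha beta gamma : R)
    (halpha : 0 <= alpha < 1) (hgamma : 1 / 2 <= gamma < 1)
    (hbeta : 0 < beta) (hbg : 0 < beta * gamma <= 1) :
  exists n0 : nat, forall n : nat, (n0 <= n)%N ->
    let F (G : sgraph n) := lambda_max alpha G - beta * lambda_min gamma G in
    maximizer F (kite n) /\
    forall G : sgraph n, maximizer F G -> graph_iso G (kite n).
Proof.
have /andP[_ bg1] := hbg.
have [K KP] := kite_unique_large halpha hgamma hbeta bg1.
(* Adding 2 excludes orders 0 and 1, and [n > K ^+ 2] gives [K <= Num.sqrt n]. *)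
exists (Num.bound (K ^+ 2)).+2 => -[|[|m]] // nm F.
have Kn : K <= Num.sqrt m.+2%:R.
  apply: le_trans (ler_norm K) _; rewrite -sqrtr_sqr ler_sqrt //.
  apply: le_trans (ltW (archi_boundP (sqr_ge0 K))) _.
  by rewrite ler_nat; apply: ltnW; apply: ltnW.
have key (H : sgraph m.+2) : graph_connected H -> F (kite m.+2) <= F H ->
    graph_iso H (kite m.+2) := KP m H Kn.
split=> [|G [cG GP]]; last exact: key G cG (GP _ (@kite_connected m)).
split=> [|H cH]; first exact: kite_connected.
(* A graph doing at least as well as the kite is isomorphic to it, so its value does not exceed that
   of the kite. *)
have /orP[//|/(key H cH) iso] := le_total (F H) (F (kite m.+2)).
apply: lerB; first exact: graph_iso_lambda_max_le.
by apply: ler_wpM2l; [exact: ltW | exact: graph_iso_lambda_min_le].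
Qed.
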